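(* Let $N\ge2$, $0<|q|<1$, $i,j\in\{1,\dots,N-1\}$ with $i\le j$, and let $k$ be an integer, with $k\ge0$ if $i=j$. Then the mode Poisson bracket of $s_i,s_j$ in the sector $(k)$ (see context) is obtained from $$\{s_i(n),s_j(m)\}_{(0)}=-2\ln q\,(q-q^{-1})\sum_{r\in\mathbb Z}\frac{[(N-\max(i,j))r]_q\,[\min(i,j)r]_q}{[Nr]_q}\,s_i(n-2r)\,s_j(m+2r)$$ by adding contributions from the singularities of the structure function crossed in going from sector $(0)$ to sector $(k)$, given by formal power series expansions of terms $\delta(\pm q^{\pm P_{ij}(s)}w/z)\,s_i(z)\,s_j(w)$. That is, there exist scalars $c_{s}^{\epsilon,\epsilon'}$ ($\epsilon,\epsilon'\in\{+1,-1\}$), independent of $n,m$, such that for all $n,m\in\mathbb Z$ $$\{s_i(n),s_j(m)\}_{(k)}=\{s_i(n),s_j(m)\}_{(0)}+\sum_{s}\ \sum_{\epsilon,\epsilon'=\pm1}c_s^{\epsilon,\epsilon'}\sum_{r\in\mathbb Z}\big(\epsilon\,q^{\epsilon'P_{ij}(s)}\big)^r\,s_i(n+r)\,s_j(m-r),$$ where $s$ runs over $1,\dots,k$ if $k\ge0$, and over $k+1,\dots,0$ if $k<0$.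
   Context: $[r]_q=\frac{q^r-q^{-r}}{q-q^{-1}}$; the $r=0$ term in the first sum is understood as its limit $0$. $\ln q$ is a fixed logarithm of $q$ and $q^a=e^{a\ln q}$. $\delta(x)=\sum_{n\in\mathbb Z}x^n$ as formal series. Let $$f(x)=-2\ln q\Big[\sum_{\ell\ge0}\Big(\frac{2x^2q^{2N\ell}}{1-x^2q^{2N\ell}}-\frac{x^2q^{2N\ell+2}}{1-x^2q^{2N\ell+2}}-\frac{x^2q^{2N\ell-2}}{1-x^2q^{2N\ell-2}}\Big)-\frac{x^2}{1-x^2}+\frac12\frac{x^2q^2}{1-x^2q^2}+\frac12\frac{x^2q^{-2}}{1-x^2q^{-2}}-(x\leftrightarrow x^{-1})\Big],$$ where $-(x\leftrightarrow x^{-1})$ means subtracting the whole preceding bracketed expression with $x$ replaced by $x^{-1}$. In the paper $\{t(z),t(w)\}=f(w/z)t(z)t(w)$ is the Poisson bracket of the trace generators of $\mathcal A_{q,p}(\widehat{sl}(N)_c)$ at $c=-N$, and $s_i(z)=\prod_{u=-(i-1)/2}^{(i-1)/2}t(q^uz)$, so that $$\{s_i(z),s_j(w)\}=f_{ij}(w/z)\,s_i(z)\,s_j(w),\qquad f_{ij}(x)=\sum_{u=-(i-1)/2}^{(i-1)/2}\ \sum_{v=-(j-1)/2}^{(j-1)/2}f(q^{v-u}x)$$ (sums in unit steps). The modes are $s_i(n)=\oint\frac{dz}{2\pi iz}z^{-n}s_i(z)$, the $s_i(n)$ being treated as commuting variables. Mode brackets. Candidate singularities of $f_{ij}(x)$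 lie at $|x|=|q|^{P}$ with $P\in\{\pm N\ell+v:\ \ell\in\mathbb Z_{\ge0},\ v\in\{-\tfrac{i+j}2,-\tfrac{i+j}2+1,\dots,\tfrac{i+j}2\}\}$; let $(P_{ij}(k))_{k\in\mathbb Z}$ be the increasing enumeration of this set together with $0$, with $P_{ij}(0)=0$. Sector $(k)$ is $\frac{R_1}{R_2}\in\,]|q|^{-P_{ij}(k)},|q|^{-P_{ij}(k+1)}[$. With $C_1,C_2$ circles around $0$ of radii $R_1,R_2$: (a) for $i=j$ (only $k\ge0$), $$\{s_i(n),s_i(m)\}_{(k)}=\frac12\Big(\oint_{C_1}\frac{dz}{2\pi iz}\oint_{C_2}\frac{dw}{2\pi iw}+\oint_{C_2}\frac{dz}{2\pi iz}\oint_{C_1}\frac{dw}{2\pi iw}\Big)z^{-n}w^{-m}f_{ii}(w/z)s_i(z)s_i(w);$$ (b) for $i<j$ (any $k\in\mathbb Z$), $\{s_i(n),s_j(m)\}_{(k)}=\oint_{C_1}\frac{dz}{2\pi iz}\oint_{C_2}\frac{dw}{2\pi iw}z^{-n}w^{-m}f_{ij}(w/z)s_i(z)s_j(w)$, and $\{s_j(m),s_i(n)\}_{(k)}:=-\{s_i(n),s_j(m)\}_{(k)}$. In each integral $f_{ij}(w/z)$ is replaced by its convergent Laurent series on the relevant circle $|w/z|$, and integration is term by term. A term $\delta(a\,w/z)s_i(z)s_j(w)$ contributes $\sum_{r\in\mathbb Z}a^r s_i(n+r)s_j(m-r)$ to the bracket of modes. *)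

(* Defs.v *)
(* MathComp-Analysis; complex numbers are R[i] for R : realType. *)
From HB Require Import structures.
From mathcomp Require Import all_boot all_order all_algebra.
From mathcomp Require Import finmap multiset.
From mathcomp Require Import all_classical all_reals all_analysis.
From mathcomp Require Import complex.

Set Implicit Arguments.
Unset Strict Implicit.
Unset Printing Implicit Defensive.

Import Order.TTheory GRing.Theory Num.Theory.
Import numFieldNormedType.Exports.

Local Open Scope classical_set_scope.
Local Open Scope ring_scope.
Local Open Scope complex_scope.

(* In R[i] the norm `|z| is itself an element of R[i]. *)
Definition absC (R : realType) (z : R[i]) : R := complex.Re `|z|.

Definition cexp (R : realType) (z : R[i]) : R[i] :=
  (expR (complex.Re z))%:C * (cos (complex.Im z) +i* sin (complex.Im z)).

(* The power q^a for real a, attached to the logarithm lnq of q. *)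
Definition qpow (R : realType) (lnq : R[i]) (a : R) : R[i] := cexp (a%:C * lnq).

Definition qnum (R : realType) (q : R[i]) (r : int) : R[i] :=
  (q ^ r - q ^ (- r)) / (q - q^-1).

(* f x = -2 ln q (f_half x - f_half x^-1), where f_half x is the bracketed
   expression in front of "- (x <-> x^-1)". *)
Definition f_term (R : realType) (q x : R[i]) (e : int) : R[i] :=
  (x ^+ 2 * q ^ e) / (1 - x ^+ 2 * q ^ e).

Definition f_half (R : realType) (N : nat) (q x : R[i]) : R[i] :=
  lim ((fun L : nat =>
          (\sum_(0 <= l < L)
             (2 * f_term q x (2 * N * l)%:Z
              - f_term q x ((2 * N * l)%:Z + 2)
              - f_term q x ((2 * N * l)%:Z - 2)) : R[i]^o)) @ \oo)
  - f_term q x 0 + 2^-1 * f_term q x 2 + 2^-1 * f_term q x (- 2).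

Definition f (R : realType) (N : nat) (lnq q x : R[i]) : R[i] :=
  - 2 * lnq * (f_half N q x - f_half N q x^-1).

(* The a-th value, a < i, of an index running from -(i-1)/2 to (i-1)/2. *)
Definition centered (R : realType) (i a : nat) : R := a%:R - (i%:R - 1) / 2.

Definition f_ij (R : realType) (N : nat) (lnq q : R[i]) (i j : nat) (x : R[i]) :
    R[i] :=
  \sum_(a < i) \sum_(b < j)
    f N lnq q (qpow lnq (centered R j b - centered R i a) * x).

(* The two halves of the Laurent series are required to converge separately. *)
Definition laurent_sum (R : realType) (a : int -> R[i]) (x S : R[i]) : Prop :=
  exists S1 S2 : R[i],
    [/\ (fun L : nat => (\sum_(0 <= p < L) a p%:Z * x ^ p%:Z : R[i]^o)) @ \oo
          --> (S1 : R[i]^o),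
        (fun L : nat => (\sum_(1 <= p < L) a (- p%:Z) * x ^ (- p%:Z) : R[i]^o))
          @ \oo --> (S2 : R[i]^o)
      & S = S1 + S2].

(* The series must represent F on an open annulus around the circle |x| = rho,
   which makes its coefficients unique. *)
Definition is_laurent (R : realType) (F : R[i] -> R[i]) (rho : R)
    (a : int -> R[i]) : Prop :=
  exists r1 r2 : R, 0 <= r1 < rho /\ rho < r2 /\
    forall x : R[i], r1 < absC x < r2 -> laurent_sum a x (F x).

Definition laurent (R : realType) (F : R[i] -> R[i]) (rho : R) : int -> R[i] :=
  xget (fun=> 0) [set a | is_laurent F rho a].

(* (i, n) stands for the commuting variable s_i(n); a finite multiset of such
   pairs is a monomial, and a formal (infinite) linear combination of monomials
   is the function giving the coefficient of each of them. *)
Definition mode : Type := (nat * int)%type.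

Definition monomial : Type := {mset mode}%mset.

Definition ss (i : nat) (n : int) (j : nat) (m : int) : monomial :=
  [mset (i, n); (j, m)]%mset.

(* \sum_r c r . M r; it is only used for families M with finite fibres, so the
   coefficients below are genuine finite sums. *)
Definition formal_sum (R : realType) (c : int -> R[i]) (M : int -> monomial) :
    monomial -> R[i] :=
  fun mu => \sum_(r \in [set r | M r = mu]) c r.

(* The double contour integral of z^-n w^-m F(w/z) s_i(z) s_j(w) over circles
   with |w/z| = rho: with F(x) = \sum_r a_r x^r on |x| = rho, the term a_r x^r
   integrates to a_r s_i(n+r) s_j(m-r). *)
Definition contour (R : realType) (F : R[i] -> R[i]) (rho : R)
    (i j : nat) (n m : int) : monomial -> R[i] :=
  formal_sum (laurent F rho) (fun r => ss i (n + r) j (m - r)).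

(* {s_i(n), s_j(m)} for i <= j, with C_1, C_2 of radii R1, R2.  For i = j the
   second integral has z on C_2 and w on C_1, hence |w/z| = R1/R2. *)
Definition mode_bracket (R : realType) (N : nat) (lnq q : R[i]) (i j : nat)
    (R1 R2 : R) (n m : int) : monomial -> R[i] :=
  let F := f_ij N lnq q i j in
  if i == j then
    fun mu => 2^-1 * (contour F (R2 / R1) i j n m mu
                      + contour F (R1 / R2) i j n m mu)
  else contour F (R2 / R1) i j n m.

Definition candidates {R : realType} (N i j : nat) : set R :=
  [set P | exists l t : nat, (t <= i + j)%N /\
     let v := t%:R - (i + j)%:R / 2 in
     P = (N * l)%:R + v \/ P = - (N * l)%:R + v].

Definition is_enumeration (R : realType) (N i j : nat) (P : int -> R) : Prop :=
  [/\ {homo P : a b / a < b}, range P = candidates N i j `|` [set 0]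
    & P 0 = 0].

Definition in_sector (R : realType) (q : R[i]) (P : int -> R) (k : int)
    (R1 R2 : R) : Prop :=
  [/\ 0 < R1, 0 < R2
    & absC q `^ (- P k) < R1 / R2 < absC q `^ (- P (k + 1))].

(* 1, ..., k if k >= 0, and 0, -1, ..., k+1 if k < 0. *)
Definition crossed (k : int) : seq int :=
  if 0 <= k then [seq t%:Z | t <- iota 1 `|k|%N]
  else [seq - t%:Z | t <- iota 0 `|k|%N].

(* Main.v *)
Require Import Defs.
From mathcomp Require Import all_boot all_order all_algebra.
From mathcomp Require Import finmap multiset.
From mathcomp Require Import cyclic separable cyclotomic.
From mathcomp Require Import all_classical all_reals all_analysis.
From mathcomp Require Import complex.
From mathcomp Require Import ring lra zify.

Set Implicit Arguments.
Unset Strict Implicit.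
Unset Printing Implicit Defensive.

Import Order.TTheory GRing.Theory Num.Theory.
Import numFieldNormedType.Exports.
Local Open Scope classical_set_scope.
Local Open Scope ring_scope.
Local Open Scope complex_scope.

(** Put [y = x ^+ 2] and [Q = q ^+ (2 * N)]. The structure function is a second
difference, [f x = - 2 ln q (2 psi y - psi (y q ^ 2) - psi (y q ^ (-2)))], of a
single function [psi], essentially the logarithmic derivative of a theta
function: [psi] has simple poles at the powers of [Q], is odd under
[y -> y^-1] and satisfies [psi (Q y) = psi y + 1]. The sums defining [f_ij]
telescope, and [f_ij x] is [- 2 ln q] times a signed sum of the four values
[psi (y q ^ e)] at the corners [e = j - i, i - j, i + j, - (i + j)] ([f_ijE]).

On the shell [|Q| ^ (m + 1) < |y| < |Q| ^ m] the Laurent coefficients of [psi]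
are [Q ^ (- (m * r)) / (1 - Q ^ r)] for [r != 0] and [m + 1/2] for [r = 0]
([laurent_psi]). For [m = 0] the positive powers form the Lambert series
[\sum_(r >= 1) y ^+ r / (1 - Q ^+ r)], which becomes the geometric series when
one subtracts its value at [Q y]; the other shells follow by quasi-periodicity.
The coefficients in the shells [m + 1] and [m] differ by [Q ^ (- ((m + 1) * r))]
([shell_coeffS]), that is, by a delta function supported at [y = Q ^ (m + 1)].

The shell boundaries of the four corners are candidate radii, so inside a sector
every corner stays in one shell ([laurent_f_ij_sector]). Going from sector
[s - 1] to sector [s], the corners having a pole at [|x| = |q| ^ P s] move up by
one shell and the others stay ([shell_index_jump]); in terms of [x] a jump is a
sum of delta functions at [x = q ^ P s] and [x = - q ^ P s]
([corner_coeff_jump]). Adding the jumps from [0] to [k] gives the second half of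
the theorem. When [i = j], the second circle has the inverse radius, and
[f_ij x^-1 = - f_ij x] carries everything over, with [- P s] in place of [P s]
([laurent_sectorV]). In the sector [0] the shells of the four corners are known
explicitly, and putting the four coefficients over the common denominator
[1 - Q ^ r] produces the quotient of q-numbers ([sector0_coeff]).

Laurent coefficients are unique because they are recovered by averaging over
roots of unity of growing order ([laurent_coeff0]); hence the series found above
are those which enter the contour integrals ([laurentE]). Finally, a given
monomial occurs finitely often in a family [s_i(n + r) s_j(m - r)], so formal
sums over [r] can be added and reindexed. *)

(** * Absolute value and convergence of complex sequences *)

Lemma absCE (R : realType) (z : R[i]) : `|z| = (absC z)%:C.
Proof. by rewrite /absC RRe_real// normr_real. Qed.

Lemma absC_ge0 (R : realType) (z : R[i]) : 0 <= absC z.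
Proof. by rewrite -ler0c -absCE normr_ge0. Qed.

Lemma absCM (R : realType) (x y : R[i]) : absC (x * y) = absC x * absC y.
Proof. by apply: complexI; rewrite rmorphM /= -!absCE normrM. Qed.

Lemma absC_eq0 (R : realType) (x : R[i]) : (absC x == 0) = (x == 0).
Proof. by rewrite -(inj_eq (@complexI R)) -absCE normr_eq0. Qed.

Lemma absC_gt0 (R : realType) (x : R[i]) : (0 < absC x) = (x != 0).
Proof. by rewrite lt_neqAle absC_ge0 andbT eq_sym absC_eq0. Qed.

Lemma absC0 (R : realType) : absC (0 : R[i]) = 0.
Proof. by apply/eqP; rewrite absC_eq0. Qed.

Lemma absC1 (R : realType) : absC (1 : R[i]) = 1.
Proof. by apply: complexI; rewrite -absCE normr1. Qed.

Lemma absCN (R : realType) (x : R[i]) : absC (- x) = absC x.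
Proof. by apply: complexI; rewrite -!absCE normrN. Qed.

Lemma absCV (R : realType) (x : R[i]) : absC x^-1 = (absC x)^-1.
Proof. by apply: complexI; rewrite -absCE fmorphV /= -absCE normfV. Qed.

Lemma absCX (R : realType) (x : R[i]) n : absC (x ^+ n) = absC x ^+ n.
Proof. by apply: complexI; rewrite -absCE rmorphXn /= -absCE normrX. Qed.

Lemma absCXz (R : realType) (x : R[i]) (n : int) : absC (x ^ n) = absC x ^ n.
Proof. by case: n => n; rewrite ?NegzE -?exprnN -?exprnP ?absCV absCX. Qed.

Lemma absC_real (R : realType) (x : R) : absC x%:C = `|x|.
Proof. by apply: complexI; rewrite -absCE normc_def /= expr0n addr0 sqrtr_sqr. Qed.

Lemma absCD (R : realType) (x y : R[i]) : absC (x + y) <= absC x + absC y.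
Proof. by rewrite -lecR rmorphD /= -!absCE ler_normD. Qed.

Lemma absCB (R : realType) (x y : R[i]) : absC x - absC y <= absC (x - y).
Proof. by rewrite -lecR rmorphB /= -!absCE lerB_dist. Qed.

Lemma absC_sum (R : realType) (I : Type) (r : seq I) (P : pred I) (F : I -> R[i]) :
  absC (\sum_(i <- r | P i) F i) <= \sum_(i <- r | P i) absC (F i).
Proof.
by rewrite -lecR rmorph_sum /= -absCE (le_trans (ler_norm_sum _ _ _))//.
Qed.

Lemma absC_Re (R : realType) (z : R[i]) : `|complex.Re z| <= absC z.
Proof. by rewrite -lecR -absCE normc_ge_Re. Qed.

Lemma absC_Im (R : realType) (z : R[i]) : `|complex.Im z| <= absC z.
Proof.
rewrite -(mul1r (absC z)).
have <- : absC 'i%C = 1 :> R.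
  by rewrite /absC normc_def /= expr0n add0r expr1n sqrtr1.
by rewrite mulrC -absCM (le_trans _ (absC_Re _))// ReiNIm normrN.
Qed.

(** The norm of [R[i]] takes its values in [R[i]]. Passing to [absC] lets
real-valued squeeze and comparison arguments be used for complex sequences. *)
Lemma cvgC_absP (R : realType) (u : nat -> R[i]) (l : R[i]) :
  (u @ \oo --> (l : R[i]^o)) <->
  ((fun n => absC (l - u n)) @ \oo --> (0 : R)).
Proof.
have P := cvgrPdist_lt (FF := eventually_filter) (u : nat -> R[i]^o) l.
split=> [/(P.1) h|/cvgrPdist_lt h].
  apply/cvgrPdist_lt => e e0.
  have /h : 0 < e%:C :> R[i] by rewrite (ltcR 0).
  apply: filterS => n; rewrite absCE ltcR sub0r normrN ger0_norm//.
  exact: absC_ge0.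
apply/(P.2) => e e0.
have er : e = (complex.Re e)%:C by rewrite RRe_real// ger0_real// ltW.
have /h : 0 < complex.Re e by rewrite -(ltcR 0) -er.
apply: filterS => n; rewrite [e in X in _ -> X]er absCE ltcR sub0r normrN ger0_norm//.
exact: absC_ge0.
Qed.

Lemma cvgC_geometric_bound (R : realType) (u : nat -> R[i]) (l : R[i]) (C t : R) :
  0 <= t < 1 -> (forall n, absC (l - u n) <= C * t ^+ n) ->
  u @ \oo --> (l : R[i]^o).
Proof.
move=> /andP[t0 t1] h; apply/cvgC_absP.
apply: (@squeeze_cvgr _ _ _ _ (cst 0) (geometric C t)).
- by apply: nearW => n; rewrite absC_ge0 h.
- exact: cvg_cst.
- by apply: cvg_geometric; rewrite ger0_norm.
Qed.

Lemma cvgC_absC (R : realType) (u : nat -> R[i]) (l : R[i]) :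
  u @ \oo --> (l : R[i]^o) -> (fun n => absC (u n)) @ \oo --> absC l.
Proof.
move=> /cvgC_absP h; apply/cvgrPdist_le => e e0.
move/cvgrPdist_le : h => /(_ _ e0); apply: filterS => n.
rewrite sub0r normrN ger0_norm ?absC_ge0//; apply: le_trans.
by rewrite ler_norml absCB andbT lerNl opprB -(absCN (l - u n)) opprB absCB.
Qed.

Lemma cvgC_ReIm (R : realType) (u : nat -> R[i]) (a b : R) :
  (fun n => complex.Re (u n)) @ \oo --> a ->
  (fun n => complex.Im (u n)) @ \oo --> b ->
  u @ \oo --> ((a +i* b) : R[i]^o).
Proof.
move=> ha hb; apply/cvgC_absP.
have h : (fun n => `|a - complex.Re (u n)| + `|b - complex.Im (u n)|) @ \oo
    --> (0 : R).
  have d0 (v : nat -> R) c : v @ \oo --> c -> (fun n => `|c - v n|) @ \oo --> (0 : R).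
    move=> /cvgrPdist_lt hv; apply/cvgrPdist_lt => e /hv.
    by apply: filterS => n; rewrite sub0r normrN normr_id.
  by rewrite -[X in _ --> X]addr0; apply: cvgD; apply: d0.
apply: (squeeze_cvgr _ (cvg_cst 0) h).
apply: nearW => n; rewrite absC_ge0 /=.
rewrite [X in absC X]complexE (le_trans (absCD _ _))// absCM !absC_real.
rewrite [absC 'i%C](_ : _ = 1) ?mul1r; last first.
  by rewrite /absC normc_def /= expr0n add0r expr1n sqrtr1.
by case: (u n).
Qed.

Lemma Re_sum (R : realType) (u : nat -> R[i]) n :
  complex.Re (\sum_(0 <= k < n) u k) = \sum_(0 <= k < n) complex.Re (u k).
Proof.
elim: n => [|n IH]; first by rewrite !big_geq.
by rewrite !big_nat_recr//= -IH; case: (\sum_(0 <= k < n) u k) (u n) => ? ? [].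
Qed.

Lemma Im_sum (R : realType) (u : nat -> R[i]) n :
  complex.Im (\sum_(0 <= k < n) u k) = \sum_(0 <= k < n) complex.Im (u k).
Proof.
elim: n => [|n IH]; first by rewrite !big_geq.
by rewrite !big_nat_recr//= -IH; case: (\sum_(0 <= k < n) u k) (u n) => ? ? [].
Qed.

Lemma geometric_sum_le (R : realType) (C t : R) n : 0 <= C -> 0 <= t < 1 ->
  \sum_(0 <= k < n) C * t ^+ k <= C / (1 - t).
Proof.
move=> C0 /andP[t0 t1].
have := @geometric_seriesE R C t; rewrite lt_eqF// => /(_ isT) /(congr1 (@^~ n)).
rewrite /series /= => ->; rewrite /= ler_pM2r ?invr_gt0 ?subr_gt0//.
by rewrite -[leRHS]mulr1 ler_wpM2l// lerBlDr lerDl exprn_ge0.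
Qed.

Lemma cvg_real_dominated (R : realType) (u : nat -> R) (C t : R) :
  0 <= t < 1 -> (forall n, `|u n| <= C * t ^+ n) ->
  cvg ((fun n => \sum_(0 <= k < n) u k) @ \oo).
Proof.
move=> /andP[t0 t1] h; apply: (@normed_cvg R R^o u).
apply: (@series_le_cvg _ _ (geometric C t)).
- by move=> n /=; exact: normr_ge0.
- by move=> n; rewrite (le_trans _ (h n)).
- by move=> n; exact: h.
- by apply: is_cvg_geometric_series; rewrite ger0_norm.
Qed.

Lemma cvgC_dominated (R : realType) (u : nat -> R[i]) (C t : R) :
  0 <= t < 1 -> (forall n, absC (u n) <= C * t ^+ n) ->
  exists2 S : R[i], (fun n => \sum_(0 <= k < n) u k) @ \oo --> (S : R[i]^o)
    & absC S <= C / (1 - t).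
Proof.
move=> t01 h.
have C0 : 0 <= C by have := le_trans (absC_ge0 _) (h 0%N); rewrite expr0 mulr1.
have hR : cvg ((fun n => \sum_(0 <= k < n) complex.Re (u k)) @ \oo).
  by apply: (cvg_real_dominated t01) => n; exact: le_trans (absC_Re _) (h n).
have hI : cvg ((fun n => \sum_(0 <= k < n) complex.Im (u k)) @ \oo).
  by apply: (cvg_real_dominated t01) => n; exact: le_trans (absC_Im _) (h n).
have [a ha] := (cvg_ex _).1 hR; have [b hb] := (cvg_ex _).1 hI.
have hS : (fun n => \sum_(0 <= k < n) u k) @ \oo --> ((a +i* b) : R[i]^o).
  apply: cvgC_ReIm; first by under eq_fun do rewrite Re_sum.
  by under eq_fun do rewrite Im_sum.
exists (a +i* b) => //.
have hc := cvgC_absC hS.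
rewrite -(cvg_lim (@Rhausdorff _) hc); apply: limr_le.
  by apply/cvg_ex; eexists; exact: hc.
apply: nearW => n; rewrite (le_trans (absC_sum _ _ _))//.
by rewrite (le_trans _ (geometric_sum_le n C0 t01))// ler_sum.
Qed.

Lemma cvgC_unique (R : realType) (u : nat -> R[i]) (l1 l2 : R[i]) :
  u @ \oo --> (l1 : R[i]^o) -> u @ \oo --> (l2 : R[i]^o) -> l1 = l2.
Proof. by move=> h1 h2; exact: (cvg_unique (@norm_hausdorff _ R[i]^o) h1 h2). Qed.

Lemma cvgC_cst (R : realType) (c : R[i]) :
  (fun=> c) @ \oo --> (c : R[i]^o).
Proof. exact: (@cvg_cst R[i]^o). Qed.

Lemma cvgC_D (R : realType) (u v : nat -> R[i]) (a b : R[i]) :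
  u @ \oo --> (a : R[i]^o) -> v @ \oo --> (b : R[i]^o) ->
  (fun n => u n + v n) @ \oo --> (a + b : R[i]^o).
Proof. by move=> h1 h2; exact: (@cvgD _ R[i]^o _ _ _ u v a b h1 h2). Qed.

Lemma cvgC_Z (R : realType) (c : R[i]) (u : nat -> R[i]) (a : R[i]) :
  u @ \oo --> (a : R[i]^o) -> (fun n => c * u n) @ \oo --> (c * a : R[i]^o).
Proof.
by move=> h; apply: (@cvgM R[i]^o _ \oo _ (cst c) u c a _ h); exact: cvg_cst.
Qed.

Lemma cvgC_sum (R : realType) (I : Type) (r : seq I) (u : I -> nat -> R[i])
    (l : I -> R[i]) : (forall i, u i @ \oo --> (l i : R[i]^o)) ->
  (fun n => \sum_(i <- r) u i n) @ \oo --> (\sum_(i <- r) l i : R[i]^o).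
Proof.
move=> h; elim: r => [|i r IH].
  rewrite big_nil (_ : (fun n => _) = (fun=> 0)); first exact: (@cvg_cst R[i]^o).
  by apply/funext => n; rewrite big_nil.
rewrite big_cons (_ : (fun n => _) = (fun n => u i n + \sum_(i <- r) u i n)).
  exact: cvgC_D (h i) IH.
by apply/funext => n; rewrite big_cons.
Qed.

(** Used to get geometric decay of Laurent coefficients from convergence at two
radii on either side of a given one. *)
Lemma cvgC_term_bounded (R : realType) (m : nat) (u : nat -> R[i]) (S : R[i]) :
  (fun L => \sum_(m <= p < L) u p) @ \oo --> (S : R[i]^o) ->
  exists2 C : R, 0 <= C & forall p, (m <= p)%N -> absC (u p) <= C.
Proof.
move=> /cvgC_absC h.
have /cvg_seq_bounded[M [_ hM]] : cvgn (fun L => absC (\sum_(m <= p < L) u p)).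
  by apply/cvg_ex; eexists; exact: h.
set B := M + 1; have T0 L : absC (\sum_(m <= p < L) u p) <= B.
  have /hM /(_ L Logic.I) : M < B by rewrite ltrDl.
  by rewrite /= ger0_norm ?absC_ge0.
exists (B + B) => [|p mp]; first by have := le_trans (absC_ge0 _) (T0 m); lra.
have -> : u p = \sum_(m <= k < p.+1) u k + - \sum_(m <= k < p) u k.
  by rewrite big_nat_recr//= addrAC subrr add0r.
by rewrite (le_trans (absCD _ _))// absCN lerD.
Qed.

(** * Uniqueness of Laurent coefficients *)

Lemma primitive_root_exists (R : realType) (M : nat) : (0 < M)%N ->
  exists z : R[i], M.-primitive_root z.
Proof.
pose p : {poly R[i]} := 'X^M - 1; have [r Dp] := closed_field_poly_normal p.
move=> M0; rewrite (monicP _) ?monicXnsubC // scale1r in Dp.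
have rM1 : all M.-unity_root r by apply/allP => z; rewrite -root_prod_XsubC -Dp.
have sz_r : (M < (size r).+1)%N by rewrite -(size_prod_XsubC r id) -Dp size_XnsubC.
have [|z] := hasP (has_prim_root M0 rM1 _ sz_r); last by exists z.
by rewrite -separable_prod_XsubC -Dp separable_Xn_sub_1 // pnatr_eq0 -lt0n.
Qed.

Lemma laurent_sumE (R : realType) (a : int -> R[i]) (x S : R[i]) :
  laurent_sum a x S <->
  exists S1 S2 : R[i],
    [/\ (fun L : nat => \sum_(0 <= p < L) a p%:Z * x ^ p%:Z) @ \oo
          --> (S1 : R[i]^o),
        (fun L : nat => \sum_(1 <= p < L) a (- p%:Z) * x ^ (- p%:Z)) @ \oo
          --> (S2 : R[i]^o)
      & S = S1 + S2].
Proof. by []. Qed.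

(** Merging the two halves of a Laurent series into one finite sum allows it to be
averaged over roots of unity. *)
Definition laurent_range (L : nat) : seq int :=
  [seq p%:Z | p <- index_iota 0 L] ++ [seq - p%:Z | p <- index_iota 1 L].

Lemma laurent_range_uniq L : uniq (laurent_range L).
Proof.
rewrite cat_uniq !map_inj_uniq ?iota_uniq ?andbT /=; first last.
- by move=> x y; lia.
- by move=> x y; lia.
apply/hasPn => x /mapP[p]; rewrite mem_index_iota => p1 ->.
by apply/mapP => -[k]; rewrite mem_index_iota; lia.
Qed.

Lemma mem_laurent_range L (n : int) : (`|n| < L)%N -> n \in laurent_range L.
Proof.
move=> nL; rewrite mem_cat; have [n0|n0] := lerP 0 n; apply/orP; [left|right].
  by apply/mapP; exists `|n|%N; rewrite ?mem_index_iota; lia.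
by apply/mapP; exists `|n|%N; rewrite ?mem_index_iota; lia.
Qed.

Lemma laurent_sum_range (R : realType) (a : int -> R[i]) (x S : R[i]) :
  laurent_sum a x S ->
  (fun L => \sum_(p <- laurent_range L) a p * x ^ p) @ \oo --> (S : R[i]^o).
Proof.
move=> /laurent_sumE[S1 [S2 [h1 h2 ->]]].
rewrite (_ : (fun L => _) = (fun L => \sum_(0 <= p < L) a p%:Z * x ^ p%:Z +
    \sum_(1 <= p < L) a (- p%:Z) * x ^ (- p%:Z))); first exact: cvgC_D h1 h2.
by apply/funext => L; rewrite big_cat !big_map.
Qed.

Lemma sum_expz_unity (R : realType) (M : nat) (w : R[i]) : w ^+ M = 1 ->
  \sum_(k < M) w ^+ k = if w == 1 then M%:R else 0.
Proof.
move=> wM; case: eqP => [->|/eqP w1].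
  by under eq_bigr do rewrite expr1n; rewrite sumr_const card_ord.
have := subrX1 w M; rewrite wM subrr => /esym/eqP.
by rewrite mulf_eq0 subr_eq0 (negPf w1) => /eqP.
Qed.

Lemma geometric_tail_le (R : realType) (C t : R) (K L : nat) :
  0 <= C -> 0 <= t < 1 ->
  \sum_(0 <= p < L | (K <= p)%N) C * t ^+ p <= C * t ^+ K / (1 - t).
Proof.
move=> C0 t01; have /andP[t0 _] := t01.
rewrite -(@big_nat_widenl _ _ _ K 0 L xpredT)//.
rewrite -[K in \sum_(K <= _ < _) _]add0n big_addn.
rewrite (le_trans _ (@geometric_sum_le _ (C * t ^+ K) t (L - K) _ t01))//.
  by apply: ler_sum => p _; rewrite exprD (mulrC (t ^+ p)) mulrA.
by rewrite mulr_ge0// exprn_ge0.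
Qed.

(** For a root of unity of order [M], the exponents that an average confuses
with [n] are at least [M - `|n|] in size; their contribution is a tail. *)
Lemma laurent_range_tail_le (R : realType) (C t : R) (K L : nat) :
  0 <= C -> 0 <= t < 1 ->
  \sum_(p <- laurent_range L | (K <= `|p|)%N) C * t ^+ `|p|
    <= 2 * (C * t ^+ K / (1 - t)).
Proof.
move=> C0 t01; have /andP[t0 _] := t01.
rewrite big_cat !big_map /= mulr_natl mulr2n lerD//.
  exact: geometric_tail_le.
under eq_bigl do rewrite abszN; under eq_bigr do rewrite abszN /=.
rewrite (le_trans _ (geometric_tail_le K L C0 t01))//.
rewrite [leLHS]big_mkcond [leRHS]big_mkcond /=.
case: L => [|L]; first by rewrite !big_geq.
rewrite [leRHS]big_ltn// lerDr; case: ifP => // _.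
by rewrite mulr_ge0// exprn_ge0.
Qed.

Lemma cvg0_ge (R : realType) (u : nat -> R) (c : R) (K : nat) :
  u @ \oo --> (0 : R) -> (forall n, (K <= n)%N -> c <= u n) -> c <= 0.
Proof.
move=> u0 cu; rewrite -(cvg_lim (@Rhausdorff _) u0); apply: limr_ge.
  by apply/cvg_ex; eexists; exact: u0.
by exists K => // n /= /cu.
Qed.

Lemma prim_root_index_gap (R : realType) (M : nat) (w : R[i]) (p n : int) :
  M.-primitive_root w -> w ^ (p - n) == 1 -> p != n -> (M - `|n| <= `|p|)%N.
Proof.
move=> prim_w wpn pn.
have : w ^+ `|p - n|%N == 1.
  case: (p - n) wpn => k; first by [].
  by rewrite NegzE -exprnN invr_eq1.
rewrite -(prim_order_dvd prim_w) => /dvdn_leq; lia.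
Qed.

(** Averaging [w ^ (- n * k) * F (w ^ k)] over the powers of a primitive [M]-th
root of unity [w] keeps the coefficients whose index is [n] modulo [M]. As
[F = 0], the coefficient of index [n] is the opposite of the sum of the others,
which are far from [n]. *)
Lemma unit_circle_coeff_le (R : realType) (e : int -> R[i]) (C t : R)
    (M : nat) (n : int) :
  0 <= C -> 0 <= t < 1 -> (forall p, absC (e p) <= C * t ^+ `|p|) ->
  (forall z, absC z = 1 -> laurent_sum e z 0) -> (0 < M)%N ->
  absC (e n) <= 2 * (C * t ^+ (M - `|n|) / (1 - t)).
Proof.
move=> C0 t01 he h0 M0; have [w prim_w] := primitive_root_exists R M0.
have wM := prim_expr_order prim_w.
have w1 : absC w = 1.
  apply/eqP; rewrite -(pexpr_eq1 M0 (absC_ge0 _)) -absCX wM.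
  by rewrite absC1.
have w0 : w != 0 by rewrite -absC_gt0 w1 ltr01.
pose H k L := \sum_(p <- laurent_range L) e p * (w ^+ k) ^ p.
pose G L := \sum_(k < M) (w ^+ k) ^ (- n) * H k L.
have G0 : G @ \oo --> (0 : R[i]^o).
  rewrite (_ : 0 = \sum_(k < M) (w ^+ k) ^ (- n) * 0); last first.
    by rewrite big1// => k _; rewrite mulr0.
  apply: cvgC_sum => k; apply: cvgC_Z; apply: laurent_sum_range; apply: h0.
  by rewrite absCX w1 expr1n.
have GE L : G L = \sum_(p <- laurent_range L)
    e p * (if w ^ (p - n) == 1 then M%:R else 0).
  rewrite /G /H; under eq_bigr do rewrite mulr_sumr.
  rewrite exchange_big /=; apply: eq_bigr => p _.
  rewrite -(sum_expz_unity (w := w ^ (p - n))) ?mulr_sumr; last first.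
    by rewrite exprnP exprzAC -exprnP wM exp1rz.
  apply: eq_bigr => k _; rewrite mulrCA -expfzDr ?expf_neq0//.
  by congr (_ * _); rewrite !exprnP exprzAC addrC.
set T := 2 * _.
suff : M%:R * (absC (e n) - T) <= 0.
  by rewrite pmulr_rle0 ?ltr0n// subr_le0.
apply: (@cvg0_ge _ (fun L => absC (G L)) _ `|n|.+1).
  by rewrite -[X in _ --> X](@absC0 R); exact: cvgC_absC.
move=> L nL; rewrite GE (bigD1_seq n) ?laurent_range_uniq ?mem_laurent_range//=.
rewrite subrr expr0z eqxx; set s := \sum_(_ <- _ | _) _.
have sT : absC s <= M%:R * T.
  rewrite (le_trans (absC_sum _ _ _))//.
  apply: le_trans (ler_wpM2l (ler0n _ M) (laurent_range_tail_le (M - `|n|) L C0 t01)).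
  rewrite mulr_sumr [leLHS]big_mkcond [leRHS]big_mkcond /=.
  have /andP[t0 _] := t01.
  apply: ler_sum => p _; case: ifP => pn; last first.
    by case: ifP => // _; rewrite !mulr_ge0 ?exprn_ge0.
  case: (boolP (w ^ (p - n) == 1)) => wp; last first.
    rewrite mulr0 absC0; case: ifP => // _.
    by rewrite !mulr_ge0 ?exprn_ge0.
  rewrite (prim_root_index_gap prim_w wp pn) absCM mulrC ler_pM ?absC_ge0//.
  rewrite (_ : M%:R = (M%:R)%:C) ?absC_real ?ger0_norm//.
  by rewrite rmorph_nat.
have := absCB (e n * M%:R) (- s); rewrite absCN opprK.
rewrite absCM (_ : absC M%:R = M%:R); last first.
  by rewrite -(rmorph_nat (real_complex R)) absC_real ger0_norm.
by apply: le_trans; rewrite mulrBr mulrC lerB.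
Qed.

Lemma unit_circle_coeff0 (R : realType) (e : int -> R[i]) (C t : R) :
  0 <= C -> 0 <= t < 1 -> (forall p, absC (e p) <= C * t ^+ `|p|) ->
  (forall z, absC z = 1 -> laurent_sum e z 0) -> forall n, e n = 0.
Proof.
move=> C0 t01 he h0 n; apply/eqP; rewrite -absC_eq0 eq_le absC_ge0 andbT.
have /andP[t0 t1] := t01.
apply: (@cvg0_ge _ (geometric (2 * (C / (1 - t))) t) _ 0).
  by apply: cvg_geometric; rewrite ger0_norm.
move=> K _; have := @unit_circle_coeff_le _ e C t (K + `|n|).+1 n C0 t01 he h0 isT.
rewrite -addSn addnK => /le_trans; apply => /=.
rewrite [leLHS](_ : _ = 2 * (C / (1 - t)) * t ^+ K.+1); last by ring.
apply: ler_wpM2l; first by rewrite mulr_ge0// divr_ge0// subr_ge0 ltW.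
by rewrite exprS; exact: ler_piMl (exprn_ge0 _ t0) (ltW t1).
Qed.

Lemma absCM_real_expz (R : realType) (a : R[i]) (s : R) (p : int) : 0 <= s ->
  absC (a * s%:C ^ p) = absC a * s ^ p.
Proof. by move=> s0; rewrite absCM absCXz absC_real ger0_norm. Qed.

(** On a circle inside the annulus the terms decay geometrically: the positive
part by comparison with a larger circle, the negative part with a smaller one. *)
Lemma laurent_coeff0 (R : realType) (d : int -> R[i]) (r1 r2 : R) :
  0 <= r1 < r2 -> (forall x, r1 < absC x < r2 -> laurent_sum d x 0) ->
  forall n, d n = 0.
Proof.
move=> /andP[r10 r12] h n.
(* [r] is the circle of the averages, [s1] and [s2] those of the comparisons. *)
have [s1 [r [s2 [[r1s1 s1r'] [rs2 s2r2]]]]] :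
    exists s1 r s2 : R, (r1 < s1 /\ s1 < r) /\ (r < s2 /\ s2 < r2).
  exists ((3 * r1 + r2) / 4), ((2 * r1 + 2 * r2) / 4), ((r1 + 3 * r2) / 4).
  by split; split; lra.
have r0 : 0 < r by lra.
have s10 : 0 < s1 by lra.
have s20 : 0 < s2 by lra.
have /h/laurent_sumE[S1 [S2 [+ _ _]]] : r1 < absC s2%:C < r2.
  by rewrite absC_real gtr0_norm//; apply/andP; split; lra.
move=> /cvgC_term_bounded[B2 B20 hB2].
have /h/laurent_sumE[S1' [S2' [_ + _]]] : r1 < absC s1%:C < r2.
  by rewrite absC_real gtr0_norm//; apply/andP; split; lra.
move=> /cvgC_term_bounded[B1 B10 hB1].
pose e p := d p * r%:C ^ p.
pose t := Num.max (r / s2) (s1 / r).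
have t0 : 0 <= t by rewrite le_max divr_ge0// ?(ltW r0) ?(ltW s20).
have t1 : t < 1 by rewrite gt_max; apply/andP; split; rewrite ltr_pdivrMr ?mul1r.
have he p : absC (e p) <= (B1 + B2) * t ^+ `|p|.
  case: p => k.
    have hp : absC (d k) * s2 ^+ k <= B2.
      rewrite exprnP -(absCM_real_expz (d k) k (ltW s20)).
      exact: hB2.
    rewrite [leLHS](absCM_real_expz (d k) k (ltW r0)) absz_nat -exprnP.
    have {1}-> : r = s2 * (r / s2) by rewrite mulrC divfK ?gt_eqF.
    rewrite exprMn mulrA; apply: ler_pM.
    - by rewrite mulr_ge0 ?absC_ge0 ?exprn_ge0 ?(ltW s20).
    - by rewrite exprn_ge0 ?divr_ge0 ?(ltW s20) ?(ltW r0).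
    - by apply: le_trans hp _; rewrite lerDr.
    - by rewrite lerXn2r ?nnegrE ?divr_ge0 ?(ltW s20) ?(ltW r0)// le_max lexx.
  rewrite /e NegzE abszN absz_nat; set p := - k.+1%:Z.
  have hp : absC (d p) * s1 ^- k.+1 <= B1.
    rewrite exprnN -(absCM_real_expz (d p) p (ltW s10)).
    exact: (hB1 k.+1 isT).
  rewrite [leLHS](absCM_real_expz (d p) p (ltW r0)) -exprnN.
  have -> : r ^- k.+1 = s1 ^- k.+1 * (s1 / r) ^+ k.+1.
    by rewrite expr_div_n mulrA mulVf ?mul1r// expf_neq0 ?gt_eqF.
  rewrite mulrA; apply: ler_pM.
  - by rewrite mulr_ge0 ?absC_ge0 ?invr_ge0 ?exprn_ge0 ?(ltW s10).
  - by rewrite exprn_ge0 ?divr_ge0 ?(ltW s10) ?(ltW r0).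
  - by apply: le_trans hp _; rewrite lerDl.
  - by rewrite lerXn2r ?nnegrE ?divr_ge0 ?(ltW s10) ?(ltW r0)// le_max lexx orbT.
have rC0 : r%:C != 0 by rewrite -absC_gt0 absC_real gtr0_norm.
have e0 : e n = 0.
  apply: (unit_circle_coeff0 (addr_ge0 B10 B20) _ he); first by rewrite t0 t1.
  move=> z z1.
  have /h/laurent_sumE[T1 [T2 [k1 k2 k12]]] : r1 < absC (r%:C * z) < r2.
    by rewrite absCM z1 mulr1 absC_real gtr0_norm//; apply/andP; split; lra.
  have ex : forall p, d p * (r%:C * z) ^ p = e p * z ^ p.
    by move=> p; rewrite expfzMl mulrA.
  apply/laurent_sumE; exists T1, T2; split; last exact: k12.
    rewrite (_ : (fun L => _) = (fun L => \sum_(0 <= p < L)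
      d p%:Z * (r%:C * z) ^ p%:Z)); first exact: k1.
    by apply/funext => L; apply: eq_bigr => p _; rewrite -ex.
  rewrite (_ : (fun L => _) = (fun L => \sum_(1 <= p < L)
      d (- p%:Z) * (r%:C * z) ^ (- p%:Z))); first exact: k2.
  by apply/funext => L; apply: eq_bigr => p _; rewrite -ex.
by apply/eqP; move/eqP : e0; rewrite mulf_eq0 expfz_eq0 (negPf rC0) andbF orbF.
Qed.

(** * Operations on Laurent series *)

Lemma cvgC_near (R : realType) (K : nat) (u v : nat -> R[i]) (l : R[i]) :
  (forall n, (K <= n)%N -> u n = v n) ->
  u @ \oo --> (l : R[i]^o) -> v @ \oo --> (l : R[i]^o).
Proof.
move=> uv /cvgC_absP/cvgrPdist_lt h; apply/cvgC_absP/cvgrPdist_lt => e /h.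
by apply: filterS2 (nbhs_infty_ge K) => n /= /uv ->.
Qed.

Lemma cvgC_uphalf (R : realType) (u : nat -> R[i]) (l : R[i]) :
  u @ \oo --> (l : R[i]^o) -> (fun n => u (uphalf n)) @ \oo --> (l : R[i]^o).
Proof.
move=> h; apply: (cvg_comp (uphalf : nat -> nat) u _ h).
move=> A [K _ hK]; exists K.*2 => // n /= Kn; apply: hK => /=.
by move: Kn; lia.
Qed.

Lemma laurent_sum_ext (R : realType) (a b : int -> R[i]) (x S : R[i]) :
  a =1 b -> laurent_sum a x S -> laurent_sum b x S.
Proof. by move=> /funext ->. Qed.

Lemma laurent_sumD (R : realType) (a b : int -> R[i]) (x S T : R[i]) :
  laurent_sum a x S -> laurent_sum b x T ->
  laurent_sum (fun p => a p + b p) x (S + T).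
Proof.
move=> /laurent_sumE[S1 [S2 [h1 h2 ->]]] /laurent_sumE[T1 [T2 [k1 k2 ->]]].
apply/laurent_sumE; exists (S1 + T1), (S2 + T2); split; last by rewrite addrACA.
  rewrite (_ : (fun L => _) = (fun L => \sum_(0 <= p < L) a p%:Z * x ^ p%:Z +
    \sum_(0 <= p < L) b p%:Z * x ^ p%:Z)); first exact: cvgC_D h1 k1.
  by apply/funext => L; rewrite -big_split /=; under eq_bigr do rewrite mulrDl.
rewrite (_ : (fun L => _) =
  (fun L => \sum_(1 <= p < L) a (- p%:Z) * x ^ (- p%:Z) +
    \sum_(1 <= p < L) b (- p%:Z) * x ^ (- p%:Z))); first exact: cvgC_D h2 k2.
by apply/funext => L; rewrite -big_split /=; under eq_bigr do rewrite mulrDl.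
Qed.

Lemma laurent_sumZ (R : realType) (c : R[i]) (a : int -> R[i]) (x S : R[i]) :
  laurent_sum a x S -> laurent_sum (fun p => c * a p) x (c * S).
Proof.
move=> /laurent_sumE[S1 [S2 [h1 h2 ->]]].
apply/laurent_sumE; exists (c * S1), (c * S2); split; last by rewrite mulrDr.
  rewrite (_ : (fun L => _) = (fun L => c * \sum_(0 <= p < L) a p%:Z * x ^ p%:Z)).
    exact: cvgC_Z h1.
  by apply/funext => L; rewrite mulr_sumr; under eq_bigr do rewrite -mulrA.
rewrite (_ : (fun L => _) =
    (fun L => c * \sum_(1 <= p < L) a (- p%:Z) * x ^ (- p%:Z))).
  exact: cvgC_Z h2.
by apply/funext => L; rewrite mulr_sumr; under eq_bigr do rewrite -mulrA.
Qed.

(** The term of exponent [0] belongs to the nonnegative half, so it has to be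
moved from one half to the other. *)
Lemma laurent_sumV (R : realType) (a : int -> R[i]) (x S : R[i]) :
  laurent_sum a x S -> laurent_sum (fun p => a (- p)) x^-1 S.
Proof.
move=> /laurent_sumE[S1 [S2 [h1 h2 ->]]].
apply/laurent_sumE; exists (S2 + a 0), (S1 - a 0); split; last by ring.
  have h := cvgC_D h2 (@cvgC_cst _ (a 0)).
  apply: (@cvgC_near _ 1 _ _ _ _ h) => -[//|L] _.
  rewrite [in RHS]big_ltn// oppr0 expr0z mulr1 addrC.
  by congr (_ + _); apply: eq_big_nat => p _; rewrite exprz_inv.
have h := cvgC_D h1 (@cvgC_cst _ (- a 0)).
apply: (@cvgC_near _ 1 _ _ _ _ h) => -[//|L] _.
rewrite [in LHS]big_ltn// expr0z mulr1 addrAC subrr add0r.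
by apply: eq_big_nat => p _; rewrite exprz_inv opprK.
Qed.

(** Substituting [y = c * x ^+ 2] in [\sum_r a r * y ^ r]. *)
Definition square_coeff (R : realType) (a : int -> R[i]) (c : R[i]) (p : int) :
    R[i] :=
  if odd `|p| then 0 else a (p %/ 2)%Z * c ^ (p %/ 2)%Z.

Lemma square_coeff2 (R : realType) (a : int -> R[i]) (c : R[i]) (r : int) :
  square_coeff a c (2 * r) = a r * c ^ r.
Proof.
rewrite /square_coeff abszM oddM /= (_ : (2 * r %/ 2)%Z = r)//.
by rewrite mulKz.
Qed.

Lemma square_coeff_odd (R : realType) (a : int -> R[i]) (c : R[i]) (p : int) :
  odd `|p| -> square_coeff a c p = 0.
Proof. by rewrite /square_coeff => ->. Qed.

(** The exponents below [L] in [x] give those below [uphalf L] in [x ^+ 2]. *)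
Lemma laurent_sum_square (R : realType) (a : int -> R[i]) (c x S : R[i]) :
  laurent_sum a (c * x ^+ 2) S -> laurent_sum (square_coeff a c) x S.
Proof.
move=> /laurent_sumE[S1 [S2 [h1 h2 ->]]].
have ev (p : int) : square_coeff a c (2 * p) * x ^ (2 * p) = a p * (c * x ^+ 2) ^ p.
  by rewrite square_coeff2 expfzMl exprnP exprz_exp mulrA.
apply/laurent_sumE; exists S1, S2; split; last by [].
  rewrite (_ : (fun L => _) = (fun L =>
    (fun M => \sum_(0 <= p < M) a p%:Z * (c * x ^+ 2) ^ p%:Z) (uphalf L))).
    exact: cvgC_uphalf h1.
  apply/funext; elim=> [|L IH] /=; first by rewrite !big_geq.
  rewrite big_nat_recr// IH uphalf_half; case: (boolP (odd L)) => oL /=.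
    by rewrite square_coeff_odd// mul0r addr0.
  rewrite big_nat_recr//; congr (_ + _).
  by rewrite -ev (_ : L%:Z = 2 * L./2%:Z)//; lia.
rewrite (_ : (fun L => _) = (fun L =>
    (fun M => \sum_(1 <= p < M) a (- p%:Z) * (c * x ^+ 2) ^ (- p%:Z)) (uphalf L))).
  exact: cvgC_uphalf h2.
apply/funext; case=> [|L]; first by rewrite !big_geq.
elim: L => [|L IH] /=; first by rewrite !big_geq.
rewrite big_nat_recr//= IH /= uphalf_half; case: (boolP (odd L)) => oL /=.
  rewrite [RHS]big_nat_recr// [X in _ = X]/=; congr (_ + _).
  by rewrite -ev (_ : - L.+1%:Z = 2 * - (1 + L./2)%N%:Z)//; lia.
by rewrite square_coeff_odd ?mul0r ?addr0// abszN absz_nat /= oL.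
Qed.

Lemma laurentE (R : realType) (F : R[i] -> R[i]) (rho : R) (a : int -> R[i]) :
  is_laurent F rho a -> laurent F rho = a.
Proof.
move=> ha; have hb : is_laurent F rho (laurent F rho).
  by apply: (@xgetPex _ _ [set a | is_laurent F rho a]); exists a.
have [r1 [r2 [/andP[r10 r1r] [rr2 {}ha]]]] := ha.
have [s1 [s2 [/andP[s10 s1r] [rs2 {}hb]]]] := hb.
apply/funext => n; apply/eqP; rewrite -subr_eq0; apply/eqP.
apply: (@laurent_coeff0 _ (fun n => laurent F rho n - a n)
  (Num.max r1 s1) (Num.min r2 s2)).
  rewrite le_max r10 /= lt_min !gt_max.
  by rewrite !(lt_trans _ rr2) ?(lt_trans _ rs2).
move=> x; rewrite gt_max lt_min => /andP[/andP[x1 x2] /andP[x3 x4]].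
have := laurent_sumD (hb x _) (laurent_sumZ (-1) (ha x _)).
rewrite x1 x2 x3 x4 mulN1r subrr => /(_ isT isT); apply: laurent_sum_ext => p.
by rewrite mulN1r.
Qed.

(** * The function psi and its Laurent series *)

(** The Lambert series [\sum_(r >= 1) y ^+ r / (1 - Q ^+ r)], which is the sum of
[geo] over the orbit of [y] when [|y| < 1]. *)
Definition lambert (R : realType) (Q y : R[i]) : R[i] :=
  lim ((fun L : nat => (\sum_(0 <= r < L) y ^+ r.+1 / (1 - Q ^+ r.+1) : R[i]^o))
         @ \oo).

Definition geo (R : realType) (y : R[i]) : R[i] := y / (1 - y).

Definition geo_orbit (R : realType) (Q y : R[i]) : R[i] :=
  lim ((fun L : nat => (\sum_(0 <= l < L) geo (y * Q ^+ l) : R[i]^o)) @ \oo).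

(** Both terms of [psi] below have a pole at [y = 1]; halving the first term of
each orbit gives this pole the same weight as the others. *)
Definition balanced_orbit (R : realType) (Q y : R[i]) : R[i] :=
  geo_orbit Q y - geo y / 2.

(** [1/2 - y * theta'(y) / theta(y)], where
[theta y = \prod_(l >= 0) (1 - y * Q ^+ l) * (1 - y^-1 * Q ^+ l.+1)]. *)
Definition psi (R : realType) (Q y : R[i]) : R[i] :=
  balanced_orbit Q y - balanced_orbit Q y^-1.

(** The Laurent coefficients of [psi Q] on [|Q| ^ (m + 1) < |y| < |Q| ^ m]. *)
Definition shell_coeff (R : realType) (Q : R[i]) (m r : int) : R[i] :=
  if r == 0 then m%:~R + 2^-1 else Q ^ (- (m * r)) / (1 - Q ^ r).

Lemma limC (R : realType) (u : nat -> R[i]) (l : R[i]) :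
  u @ \oo --> (l : R[i]^o) -> lim ((u : nat -> R[i]^o) @ \oo) = l.
Proof. by move=> h; exact: (cvg_lim (@norm_hausdorff _ R[i]^o) h). Qed.

Lemma cvgC_shift (R : realType) (u : nat -> R[i]) (l : R[i]) :
  (fun n => u n.+1) @ \oo --> (l : R[i]^o) -> u @ \oo --> (l : R[i]^o).
Proof. by rewrite (@cvg_shiftS R[i]^o u). Qed.

Lemma absC_expr_neq1 (R : realType) (Q : R[i]) (n : nat) : absC Q < 1 ->
  1 - Q ^+ n.+1 != 0.
Proof.
move=> Q1; rewrite subr_eq0; apply/negP => /eqP/(congr1 (@absC R)).
rewrite absCX absC1 => /esym/eqP; rewrite pexpr_eq1 ?absC_ge0//.
by rewrite lt_eqF.
Qed.

Lemma lambert_term_le (R : realType) (Q y : R[i]) (r : nat) : absC Q < 1 ->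
  absC (y ^+ r.+1 / (1 - Q ^+ r.+1)) <= absC y / (1 - absC Q) * absC y ^+ r.
Proof.
move=> Q1; have Q10 : 0 < 1 - absC Q by rewrite subr_gt0.
rewrite absCM absCV absCX exprS mulrAC ler_wpM2r ?exprn_ge0 ?absC_ge0//.
rewrite ler_wpM2l ?absC_ge0// lef_pV2 ?posrE//; last first.
  by rewrite absC_gt0 absC_expr_neq1.
have := absCB 1 (Q ^+ r.+1); rewrite absC1 absCX; apply: le_trans.
by rewrite lerD2l lerN2 exprS ler_piMr ?absC_ge0// exprn_ile1 ?absC_ge0 ?ltW.
Qed.

Lemma cvg_lambert (R : realType) (Q y : R[i]) : absC Q < 1 -> absC y < 1 ->
  (fun L => \sum_(0 <= r < L) y ^+ r.+1 / (1 - Q ^+ r.+1)) @ \oo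
    --> (lambert Q y : R[i]^o)
  /\ absC (lambert Q y) <= absC y / (1 - absC Q) / (1 - absC y).
Proof.
move=> Q1 y1; have y01 : 0 <= absC y < 1 by rewrite absC_ge0 y1.
have [S hS hle] := cvgC_dominated y01 (fun r => lambert_term_le y r Q1).
by rewrite /lambert (limC hS).
Qed.

Lemma cvg_geo (R : realType) (y : R[i]) : absC y < 1 ->
  (fun L => \sum_(0 <= r < L) y ^+ r.+1) @ \oo --> (geo y : R[i]^o).
Proof.
move=> y1; have y1' : 1 - y != 0 by have := absC_expr_neq1 0 y1; rewrite expr1.
apply: (@cvgC_geometric_bound _ _ _ (absC (geo y)) (absC y)).
  by rewrite absC_ge0.
move=> n; rewrite -absCX -absCM le_eqVlt; apply/orP; left; apply/eqP.
congr absC; rewrite /geo.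
under eq_bigr do rewrite exprS; rewrite -mulr_sumr big_mkord.
have := subrX1 y n; set s := \sum_(_ < _) _ => hs.
have -> : y ^+ n = 1 - (1 - y) * s by rewrite -[y ^+ n](subrK 1) hs; ring.
by field.
Qed.

(** Multiplying the [r]-th term by [1 - Q ^+ r] turns the Lambert series into the
geometric series. *)
Lemma lambert_sub (R : realType) (Q y : R[i]) : absC Q < 1 -> absC y < 1 ->
  lambert Q y - lambert Q (y * Q) = geo y.
Proof.
move=> Q1 y1; have [h1 _] := cvg_lambert Q1 y1.
have yQ1 : absC (y * Q) < 1 by rewrite absCM mulr_ilt1 ?absC_ge0.
have [h2 _] := cvg_lambert Q1 yQ1.
rewrite -mulN1r; apply: cvgC_unique (cvg_geo y1).
rewrite (_ : (fun L => _) = (fun L =>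
  \sum_(0 <= r < L) y ^+ r.+1 / (1 - Q ^+ r.+1) +
  -1 * \sum_(0 <= r < L) (y * Q) ^+ r.+1 / (1 - Q ^+ r.+1))).
  exact: cvgC_D h1 (@cvgC_Z _ (-1) _ _ h2).
apply/funext => L; rewrite mulr_sumr -big_split /=; apply: eq_bigr => r _.
have := absC_expr_neq1 r Q1; rewrite exprMn => h.
by field.
Qed.

(** By [lambert_sub] the partial sums telescope, and [lambert Q (y * Q ^+ L)]
tends to [0]. *)
Lemma cvg_geo_orbit_small (R : realType) (Q y : R[i]) :
  absC Q < 1 -> absC y < 1 ->
  (fun L => \sum_(0 <= l < L) geo (y * Q ^+ l)) @ \oo
    --> (lambert Q y : R[i]^o).
Proof.
move=> Q1 y1; have Q01 : 0 <= absC Q < 1 by rewrite absC_ge0.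
have yQ L : absC (y * Q ^+ L) <= absC y.
  by rewrite absCM absCX ler_piMr ?absC_ge0// exprn_ile1 ?absC_ge0 ?ltW.
have tel L : \sum_(0 <= l < L) geo (y * Q ^+ l)
    = lambert Q y - lambert Q (y * Q ^+ L).
  elim: L => [|L IH]; first by rewrite big_geq// expr0 mulr1 subrr.
  rewrite big_nat_recr; last by [].
  rewrite /= IH -(@lambert_sub _ Q (y * Q ^+ L) Q1 (le_lt_trans (yQ L) y1)).
  have -> : y * Q ^+ L.+1 = y * Q ^+ L * Q by rewrite exprSr mulrA.
  by move: (lambert Q y) (lambert Q (y * Q ^+ L)) (lambert Q _) => A B C; ring.
apply: (@cvgC_geometric_bound _ _ _ (absC y / (1 - absC Q) / (1 - absC y)) _ Q01).
move=> L; rewrite tel opprB addrC subrK.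
have [_ /le_trans ->//] := cvg_lambert Q1 (le_lt_trans (yQ L) y1).
have A0 : 0 < 1 - absC Q by rewrite subr_gt0.
have B0 : 0 < 1 - absC y by rewrite subr_gt0.
rewrite [leLHS]mulrAC -mulrA -mulrA [X in X * _]absCM absCX.
rewrite [leRHS](_ : _ = absC y * absC Q ^+ L * ((1 - absC y)^-1 / (1 - absC Q))); last by ring.
apply: ler_wpM2l; first by rewrite mulr_ge0 ?exprn_ge0 ?absC_ge0.
rewrite ler_wpM2r ?invr_ge0 ?(ltW A0)// lef_pV2 ?posrE//.
  by rewrite lerD2l lerN2.
by rewrite subr_gt0 (le_lt_trans (yQ L)).
Qed.

Lemma cvg_geo_orbit_step (R : realType) (Q y s : R[i]) :
  (fun L => \sum_(0 <= l < L) geo (y * Q * Q ^+ l)) @ \oo --> (s : R[i]^o) ->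
  (fun L => \sum_(0 <= l < L) geo (y * Q ^+ l)) @ \oo --> (geo y + s : R[i]^o).
Proof.
move=> h; apply: cvgC_shift.
rewrite (_ : (fun n => _) =
  (fun L => geo y + \sum_(0 <= l < L) geo (y * Q * Q ^+ l))).
  by apply: cvgC_D h; exact: cvgC_cst.
apply/funext => L; rewrite big_ltn// expr0 mulr1; congr (_ + _).
by rewrite big_add1; apply: eq_bigr => l _; rewrite exprS mulrA.
Qed.

(** Finitely many steps along the orbit reach the unit disc. Poles are harmless
for convergence, because [geo 1 = 0] by the convention on division by [0]. *)
Lemma cvg_geo_orbit (R : realType) (Q y : R[i]) : absC Q < 1 ->
  (fun L => \sum_(0 <= l < L) geo (y * Q ^+ l)) @ \oo
    --> (geo_orbit Q y : R[i]^o).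
Proof.
move=> Q1; suff [s hs] : exists s : R[i],
    (fun L => \sum_(0 <= l < L) geo (y * Q ^+ l)) @ \oo --> (s : R[i]^o).
  by rewrite /geo_orbit (limC hs).
have [n yn] : exists n, absC y * absC Q ^+ n < 1.
  have /cvgrPdist_lt/(_ 1 ltr01)[n _ /(_ n (leqnn n))] :
      geometric (absC y) (absC Q) @ \oo --> (0 : R).
    by apply: cvg_geometric; rewrite ger0_norm ?absC_ge0.
  rewrite /= sub0r normrN ger0_norm ?mulr_ge0 ?exprn_ge0 ?absC_ge0// => ?.
  by exists n.
elim: n y yn => [|n IH] y yn.
  by exists (lambert Q y); apply: cvg_geo_orbit_small; rewrite // -[absC y]mulr1.
have /IH[s hs] : absC (y * Q) * absC Q ^+ n < 1 by rewrite absCM -mulrA -exprS.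
by exists (geo y + s); exact: cvg_geo_orbit_step.
Qed.

Lemma geo_orbitS (R : realType) (Q y : R[i]) : absC Q < 1 ->
  geo_orbit Q y = geo y + geo_orbit Q (y * Q).
Proof.
move=> Q1; have h := @cvg_geo_orbit _ Q (y * Q) Q1.
exact: cvgC_unique (@cvg_geo_orbit _ Q y Q1) (@cvg_geo_orbit_step _ Q y _ h).
Qed.

Lemma geo_orbit_small (R : realType) (Q y : R[i]) : absC Q < 1 -> absC y < 1 ->
  geo_orbit Q y = lambert Q y.
Proof.
move=> Q1 y1; have h := @cvg_geo_orbit_small _ Q y Q1 y1.
exact: cvgC_unique (@cvg_geo_orbit _ Q y Q1) h.
Qed.

Lemma geoV (R : realType) (y : R[i]) : y != 0 -> y != 1 ->
  geo y + geo y^-1 = -1.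
Proof.
move=> y0 y1; rewrite /geo; have y1' : 1 - y != 0 by rewrite subr_eq0 eq_sym.
have -> : y^-1 / (1 - y^-1) = - (1 - y)^-1.
  have -> : 1 - y^-1 = - (1 - y) / y by field.
  by field; rewrite y0 y1'.
by field.
Qed.

Lemma psiV (R : realType) (Q y : R[i]) : psi Q y^-1 = - psi Q y.
Proof. by rewrite /psi /balanced_orbit invrK; ring. Qed.

(** [psi Q y - psi Q (y * Q)] is half of [geo y + geo y^-1] plus half of
[geo (y * Q) + geo (y * Q)^-1], and both of these sums are [- 1] by [geoV]. *)
Lemma psi_shift (R : realType) (Q y : R[i]) : Q != 0 -> absC Q < 1 ->
  y != 0 -> y != 1 -> y * Q != 1 -> psi Q (y * Q) = psi Q y + 1.
Proof.
move=> Q0 Q1 y0 y1 yQ1; have yQ0 : y * Q != 0 by rewrite mulf_neq0.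
have e1 : geo y^-1 = -1 - geo y by rewrite -(geoV y0 y1); ring.
have e2 : geo (y * Q)^-1 = -1 - geo (y * Q) by rewrite -(geoV yQ0 yQ1); ring.
rewrite /psi /balanced_orbit (geo_orbitS y Q1) (geo_orbitS (y * Q)^-1 Q1).
have -> : (y * Q)^-1 * Q = y^-1 by rewrite invfM mulfVK.
by rewrite e1 e2; field.
Qed.

Lemma psi_base (R : realType) (Q y : R[i]) : absC Q < 1 ->
  absC Q < absC y < 1 ->
  psi Q y = 2^-1 + lambert Q y - lambert Q (Q * y^-1).
Proof.
move=> Q1 /andP[Qy y1].
have y0 : y != 0 by rewrite -absC_gt0 (le_lt_trans (absC_ge0 Q)).
have yn1 : y != 1 by apply: contraTneq y1 => ->; rewrite absC1 ltxx.
have e1 : geo y^-1 = -1 - geo y by rewrite -(geoV y0 yn1); ring.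
rewrite /psi /balanced_orbit (geo_orbit_small Q1 y1) (geo_orbitS y^-1 Q1) (mulrC y^-1).
have Qy' : absC (Q * y^-1) < 1.
  by rewrite absCM absCV ltr_pdivrMr ?mul1r// absC_gt0.
by rewrite (geo_orbit_small Q1 Qy') e1; field.
Qed.

Lemma laurent_sum_scale (R : realType) (a : int -> R[i]) (c x S : R[i]) :
  laurent_sum a (c * x) S -> laurent_sum (fun p => a p * c ^ p) x S.
Proof.
move=> /laurent_sumE[S1 [S2 [h1 h2 ->]]].
apply/laurent_sumE; exists S1, S2; split; last by [].
  rewrite (_ : (fun L => _) = (fun L => \sum_(0 <= p < L) a p%:Z * (c * x) ^ p%:Z)).
    exact: h1.
  by apply/funext => L; apply: eq_bigr => p _; rewrite expfzMl mulrA.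
rewrite (_ : (fun L => _) =
    (fun L => \sum_(1 <= p < L) a (- p%:Z) * (c * x) ^ (- p%:Z))).
  exact: h2.
by apply/funext => L; apply: eq_bigr => p _; rewrite expfzMl mulrA.
Qed.

Lemma laurent_sum_const (R : realType) (c x : R[i]) :
  laurent_sum (fun p => if p == 0 then c else 0) x c.
Proof.
apply/laurent_sumE; exists c, 0; split; last by rewrite addr0.
  apply: cvgC_shift.
  rewrite (_ : (fun n => _) = fun=> c); first exact: cvgC_cst.
  apply/funext => L; rewrite big_ltn//= expr0z mulr1 big1_seq ?addr0// => p.
  by rewrite mem_index_iota; case: p => //= p _; rewrite mul0r.
rewrite (_ : (fun n => _) = fun=> 0); first exact: cvgC_cst.
apply/funext => L; rewrite big1_seq// => p; rewrite mem_index_iota.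
by case: p => //= p _; rewrite mul0r.
Qed.

Lemma laurent_psi_base (R : realType) (Q y : R[i]) : Q != 0 -> absC Q < 1 ->
  absC Q < absC y < 1 -> laurent_sum (shell_coeff Q 0) y (psi Q y).
Proof.
move=> Q0 Q1 Qy1; have /andP[Qy y1] := Qy1; rewrite (psi_base Q1 Qy1).
have y0 : y != 0 by rewrite -absC_gt0 (le_lt_trans (absC_ge0 Q)).
have [h1 _] := cvg_lambert Q1 y1.
have Qy' : absC (Q * y^-1) < 1.
  by rewrite absCM absCV ltr_pdivrMr ?mul1r// absC_gt0.
have [h2 _] := cvg_lambert Q1 Qy'.
apply/laurent_sumE; exists (2^-1 + lambert Q y), (- 1 * lambert Q (Q * y^-1)).
split; last by rewrite mulN1r.
  apply: cvgC_shift; rewrite (_ : (fun n => _) =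
    (fun L => 2^-1 + \sum_(0 <= r < L) y ^+ r.+1 / (1 - Q ^+ r.+1))).
    by apply: cvgC_D h1; exact: cvgC_cst.
  apply/funext => L; rewrite big_ltn//; congr (_ + _).
    by rewrite /shell_coeff eqxx expr0z mulr1 add0r.
  rewrite big_add1; apply: eq_bigr => r _.
  by rewrite /shell_coeff /= mul0r oppr0 expr0z mul1r mulrC -!exprnP.
apply: cvgC_shift; rewrite (_ : (fun n => _) =
    (fun L => -1 * \sum_(0 <= r < L) (Q * y^-1) ^+ r.+1 / (1 - Q ^+ r.+1))).
  exact: cvgC_Z h2.
apply/funext => L; rewrite big_add1 mulr_sumr; apply: eq_bigr => r _.
rewrite /shell_coeff oppr_eq0 /= mul0r oppr0 expr0z mul1r -!exprnN.
rewrite exprMn exprVn; have := absC_expr_neq1 r Q1.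
have : Q ^+ r.+1 != 0 by rewrite expf_neq0.
have : y ^+ r.+1 != 0 by rewrite expf_neq0.
move: (Q ^+ r.+1) (y ^+ r.+1) => A B B0 A0 A1.
have -> : 1 - A^-1 = - (1 - A) / A by field.
by field; rewrite A0 A1 B0.
Qed.

Lemma psi_shiftX (R : realType) (Q y : R[i]) (n : nat) : Q != 0 -> absC Q < 1 ->
  y != 0 -> absC y < 1 -> psi Q (y * Q ^+ n) = psi Q y + n%:R.
Proof.
move=> Q0 Q1 y0 y1; elim: n => [|n IH]; first by rewrite expr0 mulr1 addr0.
have lt1 k : absC (y * Q ^+ k) < 1.
  by rewrite absCM absCX (le_lt_trans _ y1)// ler_piMr ?absC_ge0 ?exprn_ile1 ?absC_ge0 ?ltW.
have ne1 k : y * Q ^+ k != 1.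
  by apply: contraTneq (lt1 k) => ->; rewrite absC1 ltxx.
have := ne1 n.+1; rewrite exprSr mulrA => ne.
rewrite psi_shift ?mulf_neq0 ?expf_neq0//.
by rewrite IH -addrA -natr1.
Qed.

Lemma psi_shiftXz (R : realType) (Q y : R[i]) (m : int) : Q != 0 -> absC Q < 1 ->
  absC Q < absC y < 1 -> psi Q (y * Q ^ m) = psi Q y + m%:~R.
Proof.
move=> Q0 Q1 /andP[Qy y1].
have y0 : y != 0 by rewrite -absC_gt0 (le_lt_trans (absC_ge0 Q)).
case: m => n; first exact: psi_shiftX.
(* The oddness of [psi] reflects negative shifts to positive ones, applied to
   [Q / y], which also lies in the shell [0]. *)
have z0 : Q * y^-1 != 0 by rewrite mulf_neq0 ?invr_eq0.
have z1 : absC (Q * y^-1) < 1.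
  by rewrite absCM absCV ltr_pdivrMr ?mul1r// absC_gt0.
have z1' : Q * y^-1 != 1 by apply: contraTneq z1 => ->; rewrite absC1 ltxx.
have yn1 : y != 1 by apply: contraTneq y1 => ->; rewrite absC1 ltxx.
have -> : y * Q ^ Negz n = (Q * y^-1 * Q ^+ n)^-1.
  by rewrite NegzE -exprnN mulrAC -exprS invfM invrK mulrC.
rewrite psiV psi_shiftX//.
have -> : Q * y^-1 = y^-1 * Q by rewrite mulrC.
rewrite psi_shift ?invr_eq0//; last by rewrite mulrC.
  by rewrite psiV NegzE mulrNz -pmulrn -natr1; ring.
by rewrite invr_eq1.
Qed.

(** Rescaling [y] by [Q ^ (- m)] brings it to the shell [0]; quasi-periodicity
then only adds [m] to the constant coefficient. *)
Lemma laurent_psi (R : realType) (Q y : R[i]) (m : int) : Q != 0 -> absC Q < 1 ->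
  absC Q ^ (m + 1) < absC y < absC Q ^ m ->
  laurent_sum (shell_coeff Q m) y (psi Q y).
Proof.
move=> Q0 Q1 /andP[Qy yQ].
have aQ0 : 0 < absC Q by rewrite absC_gt0.
have aQm0 : 0 < absC Q ^ m by rewrite exprz_gt0.
pose z := Q ^ (- m) * y.
have zE : y = z * Q ^ m.
  by rewrite /z mulrAC -expfzDr// addNr expr0z mul1r.
have hz : absC Q < absC z < 1.
  rewrite absCM absCXz -invr_expz mulrC ltr_pdivlMr// ltr_pdivrMr// mul1r yQ andbT.
  by rewrite -[X in X * _]expr1z -expfzDr ?gt_eqF// addrC.
have := laurent_psi_base Q0 Q1 hz => /laurent_sum_scale h.
rewrite [in psi Q y]zE psi_shiftXz//.
apply: laurent_sum_ext (laurent_sumD h (laurent_sum_const m%:~R y)) => r.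
rewrite /shell_coeff; case: eqP => [->|r0].
  by rewrite expr0z mulr1 add0r addrC.
by rewrite addr0 mul0r oppr0 expr0z mul1r exprz_exp mulNr mulrC.
Qed.

Lemma f_term_geo (R : realType) (q x : R[i]) (e : int) :
  f_term q x e = geo (x ^+ 2 * q ^ e).
Proof. by []. Qed.

Lemma f_halfE (R : realType) (N : nat) (q x : R[i]) :
  (0 < N)%N -> q != 0 -> absC q < 1 -> let Q := q ^+ (2 * N) in
  f_half N q x = 2 * balanced_orbit Q (x ^+ 2) - balanced_orbit Q (x ^+ 2 * q ^ 2)
                 - balanced_orbit Q (x ^+ 2 * q ^ (- 2)).
Proof.
move=> N0 q0 q1 Q; have Q1 : absC Q < 1.
  by rewrite absCX exprn_ilt1 ?absC_ge0// muln_eq0 /= -lt0n.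
have h y := @cvg_geo_orbit _ Q y Q1.
have hD := cvgC_D (cvgC_D (@cvgC_Z _ 2 _ _ (h (x ^+ 2)))
  (@cvgC_Z _ (-1) _ _ (h (x ^+ 2 * q ^ 2)))) (@cvgC_Z _ (-1) _ _ (h (x ^+ 2 * q ^ (- 2)))).
rewrite /f_half; set u := fun L : nat => _.
have {hD} hu : u @ \oo --> (2 * geo_orbit Q (x ^+ 2)
    + -1 * geo_orbit Q (x ^+ 2 * q ^ 2)
    + -1 * geo_orbit Q (x ^+ 2 * q ^ (- 2)) : R[i]^o).
  rewrite (_ : u = (fun L => 2 * \sum_(0 <= l < L) geo (x ^+ 2 * Q ^+ l)
    + -1 * \sum_(0 <= l < L) geo (x ^+ 2 * q ^ 2 * Q ^+ l)
    + -1 * \sum_(0 <= l < L) geo (x ^+ 2 * q ^ (- 2) * Q ^+ l))).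
    exact: hD.
  apply/funext => L; rewrite /u !mulr_sumr -!big_split /=; apply: eq_bigr => l _.
  have QE : Q ^+ l = q ^ (2 * N * l)%:Z by rewrite /Q -exprM exprnP.
  have E e : x ^+ 2 * q ^ e * Q ^+ l = x ^+ 2 * q ^ ((2 * N * l)%:Z + e).
    by rewrite QE -mulrA -expfzDr// addrC.
  by rewrite !f_term_geo !mulN1r -(E 2) -(E (- 2)) QE.
rewrite (limC hu) !f_term_geo expr0z mulr1 /balanced_orbit.
by field.
Qed.

Lemma fE (R : realType) (N : nat) (lnq q x : R[i]) :
  (0 < N)%N -> q != 0 -> absC q < 1 -> let Q := q ^+ (2 * N) in
  f N lnq q x = - 2 * lnq * (2 * psi Q (x ^+ 2) - psi Q (x ^+ 2 * q ^ 2)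
                             - psi Q (x ^+ 2 * q ^ (- 2))).
Proof.
move=> N0 q0 q1 Q; rewrite /f !f_halfE// -/Q.
have -> : x^-1 ^+ 2 * q ^ 2 = (x ^+ 2 * q ^ (- 2))^-1.
  by rewrite invfM exprVn invr_expz opprK.
have -> : x^-1 ^+ 2 * q ^ (- 2) = (x ^+ 2 * q ^ 2)^-1.
  by rewrite invfM exprVn invr_expz.
rewrite exprVn /psi /balanced_orbit; congr (_ * _); ring.
Qed.

(** * Powers of q and the four corners *)

Lemma cexpD (R : realType) (z w : R[i]) : cexp (z + w) = cexp z * cexp w.
Proof.
case: z w => [a b] [c d]; rewrite /cexp /= expRD cosD sinD.
by simpc; congr (_ +i* _); ring.
Qed.

Lemma absC_cexp (R : realType) (z : R[i]) : absC (cexp z) = expR (complex.Re z).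
Proof.
rewrite /cexp absCM absC_real ger0_norm ?expR_ge0//.
rewrite [X in _ * X](_ : _ = 1) ?mulr1//.
by rewrite /absC normc_def /= cos2Dsin2 sqrtr1.
Qed.

Lemma qpowD (R : realType) (lnq : R[i]) (a b : R) :
  qpow lnq (a + b) = qpow lnq a * qpow lnq b.
Proof. by rewrite /qpow rmorphD mulrDl cexpD. Qed.

Lemma qpow0 (R : realType) (lnq : R[i]) : qpow lnq 0 = 1.
Proof. by rewrite /qpow mul0r /cexp /= expR0 cos0 sin0 mul1r. Qed.

Lemma qpow_neq0 (R : realType) (lnq : R[i]) (a : R) : qpow lnq a != 0.
Proof. by rewrite -absC_gt0 absC_cexp expR_gt0. Qed.

Lemma qpowN (R : realType) (lnq : R[i]) (a : R) :
  qpow lnq (- a) = (qpow lnq a)^-1.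
Proof.
apply: (mulfI (qpow_neq0 lnq a)); rewrite -qpowD subrr qpow0 mulfV//.
exact: qpow_neq0.
Qed.

Lemma qpow_nat (R : realType) (lnq : R[i]) (a : R) (n : nat) :
  qpow lnq (a * n%:R) = qpow lnq a ^+ n.
Proof.
elim: n => [|n IH]; first by rewrite mulr0 qpow0 expr0.
by rewrite -natr1 mulrDr mulr1 qpowD IH exprSr.
Qed.

Lemma qpow_int (R : realType) (lnq : R[i]) (a : R) (z : int) :
  qpow lnq (a * z%:~R) = qpow lnq a ^ z.
Proof.
case: z => n; first exact: qpow_nat.
by rewrite NegzE mulrNz mulrN qpowN -exprnN -qpow_nat.
Qed.

Lemma qpow1 (R : realType) (lnq : R[i]) : qpow lnq 1 = cexp lnq.
Proof. by rewrite /qpow mul1r. Qed.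

Lemma qpow_intE (R : realType) (lnq : R[i]) (z : int) :
  qpow lnq z%:~R = cexp lnq ^ z.
Proof. by rewrite -[z%:~R]mul1r qpow_int qpow1. Qed.

(** With [T h e = h (e + 1)], the value at [0] of
[- (T ^ i - T ^ (- i)) (T ^ j - T ^ (- j)) h]. *)
Definition corner_sum (V : comNzRingType) (h : int -> V) (i j : nat) : V :=
  h (j%:Z - i%:Z) + h (i%:Z - j%:Z) - h (i%:Z + j%:Z) - h (- (i%:Z + j%:Z)).

(** The summand is [- (T - T^-1) ^+ 2 h] at a shifted point; each of the two sums
telescopes one factor [T - T^-1]. *)
Lemma sum_second_difference (V : comNzRingType) (h : int -> V) (i j : nat) :
  \sum_(a < i) \sum_(b < j)
    (2 * h (i%:Z - j%:Z + 2 * b%:Z - 2 * a%:Z)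
     - h (i%:Z - j%:Z + 2 * b%:Z - 2 * a%:Z + 2)
     - h (i%:Z - j%:Z + 2 * b%:Z - 2 * a%:Z - 2)) = corner_sum h i j.
Proof.
have tel (d : int -> V) (t c : int) (n : nat) :
    \sum_(b < n) (d (t + c * b%:Z) - d (t + c * b%:Z + c)) = d t - d (t + c * n%:Z).
  elim: n => [|n IH]; first by rewrite big_ord0 mulr0 addr0 subrr.
  rewrite big_ord_recr /= IH addrA subrK; congr (_ - d _).
  by rewrite intS mulrDr mulr1 [c + _]addrC addrA.
pose d e := h e - h (e - 2).
transitivity (\sum_(a < i) (d (i%:Z - j%:Z - 2 * a%:Z) - d (i%:Z + j%:Z - 2 * a%:Z))).
  apply: eq_bigr => a _.
  transitivity (\sum_(b < j) (d (i%:Z - j%:Z - 2 * a%:Z + 2 * b%:Z) -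
      d (i%:Z - j%:Z - 2 * a%:Z + 2 * b%:Z + 2))).
    apply: eq_bigr => b _; rewrite /d addrK.
    by rewrite [i%:Z - j%:Z + _ - _]addrAC; ring.
  by rewrite tel; congr (_ - d _); ring.
rewrite sumrB.
have tel2 (s : int) : \sum_(a < i) d (s - 2 * a%:Z) = h s - h (s - 2 * i%:Z).
  rewrite -mulNr -(tel h s (-2) i); apply: eq_bigr => a _.
  by rewrite /d mulNr.
rewrite !tel2 /corner_sum.
have -> : i%:Z - j%:Z - 2 * i%:Z = - (i%:Z + j%:Z) by ring.
have -> : i%:Z + j%:Z - 2 * i%:Z = j%:Z - i%:Z by ring.
by ring.
Qed.

Lemma f_ijE (R : realType) (N : nat) (lnq q x : R[i]) (i j : nat) :
  (0 < N)%N -> q != 0 -> absC q < 1 -> cexp lnq = q ->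
  f_ij N lnq q i j x = - 2 * lnq *
    corner_sum (fun e => psi (q ^+ (2 * N)) (x ^+ 2 * q ^ e)) i j.
Proof.
move=> N0 q0 q1 hq; rewrite -sum_second_difference mulr_sumr /f_ij.
apply: eq_bigr => a _; rewrite mulr_sumr; apply: eq_bigr => b _.
rewrite fE//; congr (_ * _).
set t := i%:Z - j%:Z + 2 * b%:Z - 2 * a%:Z.
have -> : (qpow lnq (centered R j b - centered R i a) * x) ^+ 2 = x ^+ 2 * q ^ t.
  rewrite exprMn mulrC -qpow_nat; congr (_ * _).
  rewrite -hq -qpow_intE; congr (qpow _ _).
  rewrite /t /centered !rmorphD !rmorphN /= !rmorphM /= -!pmulrn.
  by field.
by rewrite -!mulrA -!expfzDr.
Qed.

Lemma corner_sumZ (V : comNzRingType) (c : V) (h : int -> V) (i j : nat) :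
  c * corner_sum h i j = corner_sum (fun e => c * h e) i j.
Proof. by rewrite /corner_sum !mulrDr !mulrN. Qed.

Lemma corner_sumB (V : comNzRingType) (h g : int -> V) (i j : nat) :
  corner_sum h i j - corner_sum g i j = corner_sum (fun e => h e - g e) i j.
Proof. by rewrite /corner_sum; ring. Qed.

(** Inverting [x] exchanges the corners [e] and [- e], and [psi] is odd. *)
Lemma f_ijV (R : realType) (N : nat) (lnq q x : R[i]) (i j : nat) :
  (0 < N)%N -> q != 0 -> absC q < 1 -> cexp lnq = q ->
  f_ij N lnq q i j x^-1 = - f_ij N lnq q i j x.
Proof.
move=> N0 q0 q1 hq; rewrite !f_ijE// -mulrN; congr (_ * _).
have k e : psi (q ^+ (2 * N)) (x^-1 ^+ 2 * q ^ e) =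
    - psi (q ^+ (2 * N)) (x ^+ 2 * q ^ (- e)).
  by rewrite -psiV invfM exprVn invr_expz opprK.
by rewrite /corner_sum !k (opprB j%:Z i%:Z) (opprB i%:Z j%:Z) (opprK (i%:Z + j%:Z)); ring.
Qed.

(** * Sectors and shells *)

Definition corner (i j : nat) (e : int) : bool :=
  e \in [:: j%:Z - i%:Z; i%:Z - j%:Z; i%:Z + j%:Z; - (i%:Z + j%:Z)].

(** The Laurent coefficients of [f_ij] on a circle where [x ^+ 2 * q ^ e] lies in
the shell [m e] of [psi], for each corner [e]. *)
Definition corner_coeff (R : realType) (N : nat) (lnq q : R[i]) (i j : nat)
    (m : int -> int) (p : int) : R[i] :=
  - 2 * lnq * corner_sum
    (fun e => square_coeff (shell_coeff (q ^+ (2 * N)) (m e)) (q ^ e) p) i j.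

Lemma eq_corner_sum (V : comNzRingType) (h g : int -> V) (i j : nat) :
  (forall e, corner i j e -> h e = g e) -> corner_sum h i j = corner_sum g i j.
Proof.
by move=> hg; rewrite /corner_sum !hg// /corner !inE eqxx ?orbT.
Qed.

Lemma laurent_sum_corner (R : realType) (h : int -> int -> R[i])
    (S : int -> R[i]) (x : R[i]) (i j : nat) :
  (forall e, corner i j e -> laurent_sum (h e) x (S e)) ->
  laurent_sum (fun p => corner_sum (h ^~ p) i j) x (corner_sum S i j).
Proof.
move=> hS.
have h1 : laurent_sum (h (j%:Z - i%:Z)) x (S (j%:Z - i%:Z)).
  by apply: hS; rewrite /corner !inE eqxx.
have h2 : laurent_sum (h (i%:Z - j%:Z)) x (S (i%:Z - j%:Z)).
  by apply: hS; rewrite /corner !inE eqxx ?orbT.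
have h3 : laurent_sum (h (i%:Z + j%:Z)) x (S (i%:Z + j%:Z)).
  by apply: hS; rewrite /corner !inE eqxx ?orbT.
have h4 : laurent_sum (h (- (i%:Z + j%:Z))) x (S (- (i%:Z + j%:Z))).
  by apply: hS; rewrite /corner !inE eqxx ?orbT.
have := laurent_sumD (laurent_sumD (laurent_sumD h1 h2) (laurent_sumZ (-1) h3))
  (laurent_sumZ (-1) h4).
rewrite !mulN1r; apply: laurent_sum_ext => p.
by rewrite !mulN1r.
Qed.

Lemma laurent_f_ij (R : realType) (N : nat) (lnq q x : R[i]) (i j : nat)
    (m : int -> int) :
  (0 < N)%N -> q != 0 -> absC q < 1 -> cexp lnq = q ->
  (forall e, corner i j e -> absC (q ^+ (2 * N)) ^ (m e + 1)
     < absC (x ^+ 2 * q ^ e) < absC (q ^+ (2 * N)) ^ (m e)) ->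
  laurent_sum (corner_coeff N lnq q i j m) x (f_ij N lnq q i j x).
Proof.
move=> N0 q0 q1 hq hm; rewrite f_ijE//; apply: laurent_sumZ.
apply: (@laurent_sum_corner _
  (fun e => square_coeff (shell_coeff (q ^+ (2 * N)) (m e)) (q ^ e))) => e he.
apply: laurent_sum_square; rewrite mulrC; apply: laurent_psi (hm _ he).
  by rewrite expf_neq0.
by rewrite absCX exprn_ilt1 ?absC_ge0// muln_eq0 /= -lt0n.
Qed.

Lemma powR_ltl (R : realType) (a s t : R) : 0 < a < 1 ->
  (a `^ s < a `^ t) = (t < s).
Proof.
move=> /andP[a0 a1]; rewrite /powR gt_eqF// ltr_expR.
by rewrite ltr_nM2r// ln_lt0// a0 a1.
Qed.

Lemma powR_surj (R : realType) (a x : R) : 0 < a < 1 -> 0 < x ->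
  exists s, x = a `^ s.
Proof.
move=> /andP[a0 a1] x0; exists (ln x / ln a).
rewrite /powR gt_eqF// divfK ?lnK ?posrE//.
by rewrite lt_eqF// ln_lt0// a0 a1.
Qed.

Lemma exprz_powR (R : realType) (a : R) (z : int) : 0 <= a -> a ^ z = a `^ z%:~R.
Proof.
move=> a0; case: z => n; first by rewrite powR_mulrn.
by rewrite NegzE mulrNz powRN powR_mulrn.
Qed.

(** [|x ^+ 2 * q ^ e| = |Q| ^ l] means [|x| = |q| ^ (N * l - e / 2)]: the
boundaries of shells at the corners are candidate radii. *)
Lemma candidates_corner (R : realType) (N i j : nat) (e l : int) :
  corner i j e -> candidates N i j (N%:R * l%:~R - e%:~R / 2 : R).
Proof.
rewrite /corner !inE => he.
have [t tij et] : exists2 t, (t <= i + j)%N & 2 * t%:Z - (i + j)%:Z = - e.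
  case/or4P : he => /eqP ->.
  - by exists i; lia.
  - by exists j; lia.
  - by exists 0%N; lia.
  - by exists (i + j)%N; lia.
have ev : t%:R - (i + j)%:R / 2 = - e%:~R / 2 :> R.
  have /(congr1 (fun z : int => z%:~R : R)) := et.
  rewrite rmorphB rmorphM rmorphN /= -!pmulrn => <-; lra.
exists `|l|%N, t; split => //=; rewrite ev mulNr natrM.
case: l => l /=; [left|right]; first by [].
by rewrite NegzE mulrNz mulrN -pmulrn.
Qed.

Lemma enumeration_lt (R : realType) (N i j : nat) (P : int -> R) (a b : int) :
  is_enumeration N i j P -> P a < P b -> a < b.
Proof.
move=> [hP _ _]; apply: contraTT; rewrite -!leNgt le_eqVlt => /orP[/eqP ->//|/hP].
exact: ltW.
Qed.

Lemma enumeration_gap (R : realType) (N i j : nat) (P : int -> R) (k : int) (y : R) :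
  is_enumeration N i j P -> candidates N i j y -> P k < y -> P (k + 1) <= y.
Proof.
move=> hP cy; have [hmono hr _] := hP.
have : range P y by rewrite hr; left.
move=> [l _ <-] /(enumeration_lt hP).
by rewrite -lezD1 le_eqVlt => /orP[/eqP->//|/hmono/ltW].
Qed.

(** The shell of [psi] which contains [x ^+ 2 * q ^ e] when [|x|] is slightly
below [|q| ^ p]. *)
Definition shell_index (R : realType) (N : nat) (p : R) (e : int) : int :=
  Num.floor ((2 * p + e%:~R) / (2 * N)%:R).

Lemma shell_index_itv (R : realType) (N : nat) (p : R) (e : int) : (0 < N)%N ->
  (2 * N)%:R * (shell_index N p e)%:~R <= 2 * p + e%:~R
    < (2 * N)%:R * ((shell_index N p e)%:~R + 1).
Proof.
move=> N0; have N2 : 0 < (2 * N)%:R :> R by rewrite ltr0n muln_gt0.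
have := floor_itv ((2 * p + e%:~R) / (2 * N)%:R).
by rewrite ler_pdivlMr// ltr_pdivrMr// intrD !(mulrC _ (2 * N)%:R).
Qed.

(** Otherwise a shell boundary would be a candidate strictly between [P k] and
[P (k + 1)]. *)
Lemma shell_index_next (R : realType) (N i j : nat) (P : int -> R) (k e : int) :
  (0 < N)%N -> is_enumeration N i j P -> corner i j e ->
  2 * P (k + 1) + e%:~R <= (2 * N)%:R * ((shell_index N (P k) e)%:~R + 1).
Proof.
move=> N0 hP he; have /andP[_] := shell_index_itv (P k) e N0.
set m := shell_index _ _ _ => hm.
have := enumeration_gap hP (candidates_corner R N (m + 1) he).
move=> /(_ k); rewrite intrD natrM in hm *.
move=> h; have : P k < N%:R * (m%:~R + 1) - e%:~R / 2 by lra.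
by move=> /h; lra.
Qed.

(** Writing [absC x] as a power [absC q `^ s] makes all the comparisons of radii
linear in the exponents. *)
Lemma laurent_f_ij_sector (R : realType) (N : nat) (lnq q : R[i]) (i j : nat)
    (P : int -> R) (k : int) (x : R[i]) :
  (0 < N)%N -> q != 0 -> absC q < 1 -> cexp lnq = q -> is_enumeration N i j P ->
  absC q `^ P (k + 1) < absC x < absC q `^ P k ->
  laurent_sum (corner_coeff N lnq q i j (shell_index N (P k))) x
    (f_ij N lnq q i j x).
Proof.
move=> N0 q0 q1 hq hP; set a := absC q.
have a01 : 0 < a < 1 by rewrite absC_gt0 q0 q1.
have a0 : 0 <= a by exact: absC_ge0.
move=> /andP[x1 x2]; have x0 : 0 < absC x by rewrite (le_lt_trans _ x1)// powR_ge0.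
have [s sE] := powR_surj a01 x0.
move: x1 x2; rewrite sE !powR_ltl// => x1 x2.
apply: laurent_f_ij => // e he.
have hx : absC (x ^+ 2 * q ^ e) = a `^ (s * 2%:R + e%:~R).
  rewrite absCM absCX absCXz sE -/a exprz_powR// -powR_mulrn ?powR_ge0//.
  rewrite -powRrM powRD//; apply/implyP => _; rewrite /a absC_eq0//.
have hQ (z : int) : absC (q ^+ (2 * N)) ^ z = a `^ ((2 * N)%:R * z%:~R).
  by rewrite absCX -/a exprz_powR ?exprn_ge0// -powR_mulrn// -powRrM.
rewrite hx !hQ !powR_ltl// intrD.
have /andP[h1 _] := shell_index_itv (P k) e N0.
have h2 := shell_index_next k N0 hP he.
by apply/andP; split; lra.
Qed.

(** Between consecutive sectors the shell at the corner [e] changes only if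
[|x| = |q| ^ P s] is one of its boundaries. *)
Lemma shell_index_jump (R : realType) (N i j : nat) (P : int -> R) (s e : int) :
  (0 < N)%N -> is_enumeration N i j P -> corner i j e ->
  let m := shell_index N (P (s - 1)) e in
  (shell_index N (P s) e = m) \/
  (shell_index N (P s) e = m + 1 /\ 2 * P s + e%:~R = (2 * N)%:R * (m + 1)%:~R).
Proof.
move=> N0 hP he m; have N2 : 0 < (2 * N)%:R :> R by rewrite ltr0n muln_gt0.
have := shell_index_next (s - 1) N0 hP he; rewrite subrK -/m => h1.
have /andP[h2 _] := shell_index_itv (P (s - 1)) e N0.
have h3 : P (s - 1) < P s by have [hmono _ _] := hP; apply: hmono; rewrite ltrBlDr ltrDl.
have [h4|h4] := eqVneq (2 * P s + e%:~R) ((2 * N)%:R * (m%:~R + 1)); [right|left].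
  split; last by rewrite h4 intrD.
  rewrite /shell_index h4 mulrAC mulfV ?gt_eqF// mul1r -[1]/(1%:~R) -intrD.
  by rewrite intrKfloor.
apply: floor_def; rewrite ler_pdivlMr// ltr_pdivrMr// intrD !(mulrC _ (2 * N)%:R).
rewrite lt_neqAle h4 h1 andbT (le_trans h2)//; lra.
Qed.

(** * Jumps between sectors and the sector 0 *)

Lemma absC_exprz_neq1 (R : realType) (Q : R[i]) (r : int) : Q != 0 ->
  absC Q < 1 -> r != 0 -> 1 - Q ^ r != 0.
Proof.
move=> Q0 Q1; case: r => [[//|r] _|r _]; first exact: absC_expr_neq1.
have := absC_expr_neq1 r Q1; rewrite NegzE -exprnN; apply: contraNneq => /eqP.
by rewrite !subr_eq0 eq_sym invr_eq1 eq_sym.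
Qed.

Lemma shell_coeffS (R : realType) (Q : R[i]) (m r : int) : Q != 0 ->
  absC Q < 1 -> shell_coeff Q (m + 1) r - shell_coeff Q m r = Q ^ (- ((m + 1) * r)).
Proof.
move=> Q0 Q1; rewrite /shell_coeff; case: eqVneq => [->|r0].
  by rewrite mulr0 oppr0 expr0z intrD; ring.
have h := absC_exprz_neq1 Q0 Q1 r0.
have -> : Q ^ (- (m * r)) = Q ^ (- ((m + 1) * r)) * Q ^ r.
  by rewrite -expfzDr//; congr (Q ^ _); ring.
by field.
Qed.

(** The coefficient of the delta functions crossed at [P s]; the corner sum counts
with signs the corners that have a pole there. *)
Definition jump_weight (R : realType) (N : nat) (lnq : R[i]) (i j : nat)
    (P : int -> R) (s : int) : R[i] :=
  - lnq * corner_sum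
    (fun e => (shell_index N (P s) e - shell_index N (P (s - 1)) e)%:~R) i j.

(** [\delta(w x) + \delta(- w x)] only involves even powers of [x]. *)
Lemma sum_signs_expz (R : realType) (w : R[i]) (p : int) :
  \sum_(e : bool) ((-1) ^+ e * w) ^ p = if odd `|p| then 0 else 2 * w ^ p.
Proof.
rewrite big_bool expr1 expr0 mul1r expfzMl.
have -> : (-1 : R[i]) ^ p = (-1) ^+ `|p|.
  case: p => n; first by [].
  by rewrite NegzE -exprnN abszN absz_nat -signr_odd; case: odd => /=;
    rewrite ?expr1 ?invrN ?invr1 ?expr0 ?invr1.
rewrite -signr_odd; case: odd => /=; first by rewrite expr1; ring.
by rewrite expr0; ring.
Qed.

(** The jump of [psi] at [y = x ^+ 2 * q ^ e = Q ^ (m + 1)] gives the even powers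
of [q ^ (- P s) * x], hence equal weights for the two signs: [f_ij] depends on
[x ^+ 2] only. *)
Lemma corner_coeff_jump (R : realType) (N : nat) (lnq q : R[i]) (i j : nat)
    (P : int -> R) (s p : int) :
  (0 < N)%N -> q != 0 -> absC q < 1 -> cexp lnq = q -> is_enumeration N i j P ->
  corner_coeff N lnq q i j (shell_index N (P s)) p
  - corner_coeff N lnq q i j (shell_index N (P (s - 1))) p
  = jump_weight N lnq i j P s
    * \sum_(e : bool) ((-1) ^+ e * qpow lnq (- P s)) ^ p.
Proof.
move=> N0 q0 q1 hq hP; have Q0 : q ^+ (2 * N) != 0 by rewrite expf_neq0.
have Q1 : absC (q ^+ (2 * N)) < 1.
  by rewrite absCX exprn_ilt1 ?absC_ge0// muln_eq0 /= -lt0n.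
rewrite /corner_coeff -mulrBr corner_sumB sum_signs_expz.
set w := if _ then _ else _.
rewrite (@eq_corner_sum _ _ (fun e => w / 2 *
  (shell_index N (P s) e - shell_index N (P (s - 1)) e)%:~R)) => [|e he].
  by rewrite -corner_sumZ /jump_weight; field.
have [->|[-> hs]] := shell_index_jump s N0 hP he; first by rewrite !subrr mulr0.
rewrite addrAC subrr add0r mulr1 /square_coeff /w; case: ifPn => [_|ev].
  by rewrite subrr mul0r.
have [r pr] : exists r, p = 2 * r by exists (p %/ 2)%Z; lia.
rewrite pr (_ : (2 * r %/ 2)%Z = r); last by rewrite mulKz.
rewrite -mulrBl shell_coeffS// mulrAC mulfV// mul1r.
have E1 (z : int) : (q ^+ (2 * N)) ^ z = qpow lnq ((2 * N)%:R * z%:~R).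
  by rewrite qpow_int -[(2 * N)%:R]mul1r qpow_nat qpow1 hq.
have E2 : (q ^ e) ^ r = qpow lnq (e%:~R * r%:~R) by rewrite qpow_int qpow_intE hq.
rewrite E1 E2 -qpowD -qpow_int; congr (qpow _ _).
have -> : e%:~R = (2 * N)%:R * (shell_index N (P (s - 1)) e + 1)%:~R - 2 * P s.
  by rewrite -hs addrAC subrr add0r.
by rewrite intrN !intrM; ring.
Qed.

(** For [i = j] the two circles of the bracket have inverse radii, and the oddness
of [f_ij] turns their average into the odd part of the coefficients. *)
Definition sector_coeff (R : realType) (N : nat) (lnq q : R[i]) (i j : nat)
    (P : int -> R) (k p : int) : R[i] :=
  let a := corner_coeff N lnq q i j (shell_index N (P k)) in
  if i == j then 2^-1 * (a p - a (- p)) else a p.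

Lemma shell_index0 (R : realType) (N : nat) (e m : int) : (0 < N)%N ->
  (2 * N)%:Z * m <= e < (2 * N)%:Z * (m + 1) -> shell_index N (0 : R) e = m.
Proof.
move=> N0 /andP[h1 h2]; apply: floor_def; rewrite mulr0 add0r.
rewrite ler_pdivlMr ?ltr_pdivrMr ?ltr0n ?muln_gt0//.
rewrite [(2 * N)%:R]pmulrn -!intrM ler_int ltr_int.
by rewrite ![_ * (2 * N)%:Z]mulrC h1 h2.
Qed.

Lemma exprz_subM (R : realType) (q : R[i]) (a b r : int) : q != 0 ->
  q ^ ((a - b) * r) = q ^ (a * r) / q ^ (b * r).
Proof. by move=> q0; rewrite mulrBl expfzDr// -invr_expz. Qed.

Lemma exprz_sq_neq1 (R : realType) (q : R[i]) (z : int) : q != 0 ->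
  absC q < 1 -> z != 0 -> (q ^ z) ^+ 2 - 1 != 0.
Proof.
move=> q0 q1 z0; rewrite -oppr_eq0 opprB exprnP exprz_exp.
by apply: absC_exprz_neq1; rewrite // mulf_neq0.
Qed.

(** The only shell in sector [0] that depends on whether [i = j] is the one at the
corner [i - j]; it is left as a parameter [m]. *)
Lemma corner_coeff0E (R : realType) (N : nat) (lnq q : R[i]) (i j : nat)
    (idx : int -> int) (m r : int) :
  q != 0 -> absC q < 1 -> (0 < N)%N -> r != 0 ->
  idx (j%:Z - i%:Z) = 0 -> idx (i%:Z - j%:Z) = m ->
  idx (i%:Z + j%:Z) = 0 -> idx (- (i%:Z + j%:Z)) = -1 ->
  let A := q ^ (i%:Z * r) in let B := q ^ (j%:Z * r) in
  let D := q ^ (N%:Z * r) in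
  corner_coeff N lnq q i j idx (2 * r) =
  - 2 * lnq * ((B / A + D ^ (- (2 * m)) * (A / B) - A * B - D ^+ 2 / (A * B))
               / (1 - D ^+ 2)).
Proof.
move=> q0 q1 N0 r0 h1 h2 h3 h4 A B D.
have A0 : A != 0 by rewrite expfz_neq0.
have B0 : B != 0 by rewrite expfz_neq0.
have D0 : D != 0 by rewrite expfz_neq0.
have D1 : 1 - D ^+ 2 != 0.
  rewrite -oppr_eq0 opprB; apply: exprz_sq_neq1 => //.
  by rewrite mulf_neq0//; lia.
have QD (z : int) : (q ^+ (2 * N)) ^ z = q ^ (2 * N%:Z * z).
  by rewrite exprnP exprz_exp PoszM.
have QD1 : (q ^+ (2 * N)) ^ r = D ^+ 2.
  by rewrite QD /D [RHS]exprnP exprz_exp; congr (q ^ _); ring.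
have QDm (z : int) : (q ^+ (2 * N)) ^ (- (z * r)) = D ^ (- (2 * z)).
  by rewrite QD /D exprz_exp; congr (q ^ _); ring.
rewrite /corner_coeff /corner_sum !square_coeff2 h1 h2 h3 h4.
have Eji : (q ^ (j%:Z - i%:Z)) ^ r = B / A by rewrite exprz_exp exprz_subM.
have Eij : (q ^ (i%:Z - j%:Z)) ^ r = A / B by rewrite exprz_exp exprz_subM.
have Epl : (q ^ (i%:Z + j%:Z)) ^ r = A * B by rewrite exprz_exp mulrDl expfzDr.
have Emi : (q ^ (- (i%:Z + j%:Z))) ^ r = (A * B)^-1.
  by rewrite -invr_expz exprz_inv -invr_expz Epl.
rewrite Eji Eij Epl Emi /shell_coeff (negPf r0) !QDm QD1.
rewrite mulr0 oppr0 expr0z mulrN mulr1 opprK -[D ^ 2]/(D ^+ 2).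
by congr (_ * _); field; rewrite A0 B0 D1.
Qed.

(** The shell [m] at the corner [i - j] is [0] if [i = j] and [- 1] otherwise.
The first case gives an expression which is not odd in [r], and it is the average
over the two circles that restores the same formula as in the second case. *)
Lemma sector0_coeff (R : realType) (N : nat) (lnq q : R[i]) (i j : nat)
    (P : int -> R) (r : int) :
  q != 0 -> absC q < 1 -> (2 <= N)%N -> (1 <= i <= N - 1)%N ->
  (1 <= j <= N - 1)%N -> (i <= j)%N -> P 0 = 0 ->
  sector_coeff N lnq q i j P 0 (- (2 * r)) =
  - 2 * lnq * (q - q^-1) *
   (qnum q ((N - maxn i j)%:Z * r) * qnum q ((minn i j)%:Z * r)
     / qnum q (N%:Z * r)).
Proof.
move=> q0 q1 N2 hi hj hij P0; rewrite (maxn_idPr hij) (minn_idPl hij).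
have N0 : (0 < N)%N by lia.
rewrite /sector_coeff P0; set a := corner_coeff _ _ _ _ _ _.
have idx1 : shell_index N (0 : R) (j%:Z - i%:Z) = 0 by apply: shell_index0 => //; lia.
have idx3 : shell_index N (0 : R) (i%:Z + j%:Z) = 0 by apply: shell_index0 => //; lia.
have idx4 : shell_index N (0 : R) (- (i%:Z + j%:Z)) = -1 by apply: shell_index0 => //; lia.
pose m : int := if i == j then 0 else -1.
have idx2 : shell_index N (0 : R) (i%:Z - j%:Z) = m.
  by apply: shell_index0 => //; rewrite /m; case: eqP; lia.
have q2 : q ^+ 2 - 1 != 0 := exprz_sq_neq1 q0 q1 (oner_neq0 int).
have [->|r0] := eqVneq r 0.
  have qn0 : qnum q 0 = 0 by rewrite /qnum oppr0 subrr mul0r.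
  rewrite !mulr0 oppr0 qn0 !mul0r mulr0.
  case: eqP => [_|/eqP ij]; first by rewrite subrr mulr0.
  have sq0 (b : int -> R[i]) c : square_coeff b c 0 = b 0.
    by have := square_coeff2 b c 0; rewrite mulr0 expr0z mulr1.
  rewrite /a /corner_coeff /corner_sum !sq0.
  rewrite idx1 idx2 idx3 idx4 /m (negPf ij) /shell_coeff eqxx.
  by ring.
have aE s (s0 : s != 0) :=
  @corner_coeff0E _ N lnq q i j _ m s q0 q1 N0 s0 idx1 idx2 idx3 idx4.
rewrite -/a in aE *.
have rN0 : - r != 0 by rewrite oppr_eq0.
have E1 := aE _ r0.
have := aE _ rN0; rewrite !mulrN -!invr_expz => E2.
rewrite opprK E1 E2.
have jN : (j <= N)%N by lia.
rewrite /qnum -subzn// -!invr_expz !exprz_subM//.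
have A0 : q ^ (i%:Z * r) != 0 by rewrite expfz_neq0.
have B0 : q ^ (j%:Z * r) != 0 by rewrite expfz_neq0.
have D0 : q ^ (N%:Z * r) != 0 by rewrite expfz_neq0.
have D1 : (q ^ (N%:Z * r)) ^+ 2 - 1 != 0.
  by apply: exprz_sq_neq1; rewrite // mulf_neq0//; lia.
rewrite /m; case: eqP => [<-|_].
  move: A0 D0 D1; move: (q ^ (i%:Z * r)) (q ^ (N%:Z * r)) => A D A0 D0 D1.
  rewrite !mulr0 !expr0z; field.
  by rewrite q0 q2 D0 D1 A0 -oppr_eq0 opprB D1.
move: A0 B0 D0 D1; move: (q ^ (i%:Z * r)) (q ^ (j%:Z * r)) (q ^ (N%:Z * r)) => A B D A0 B0 D0 D1.
rewrite mulrN1 -invr_expz invrK -exprnP; field.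
by rewrite q0 q2 D0 D1 A0 B0.
Qed.

Lemma corner_coeff_odd (R : realType) (N : nat) (lnq q : R[i]) (i j : nat)
    (idx : int -> int) (p : int) : odd `|p| ->
  corner_coeff N lnq q i j idx p = 0.
Proof.
by move=> op; rewrite /corner_coeff /corner_sum !square_coeff_odd//; ring.
Qed.

Lemma sector_coeff_odd (R : realType) (N : nat) (lnq q : R[i]) (i j : nat)
    (P : int -> R) (k p : int) : odd `|p| ->
  sector_coeff N lnq q i j P k p = 0.
Proof.
move=> op; rewrite /sector_coeff !corner_coeff_odd ?abszN//.
by case: ifP => // _; ring.
Qed.

Lemma sector_radius (R : realType) (q : R[i]) (P : int -> R) (k : int)
    (R1 R2 : R) : q != 0 -> in_sector q P k R1 R2 ->
  absC q `^ P (k + 1) < R2 / R1 < absC q `^ P k.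
Proof.
move=> q0 [R10 R20 /andP[h1 h2]]; have R0 : 0 < R1 / R2 by rewrite divr_gt0.
have a0 : 0 < absC q by rewrite absC_gt0.
rewrite -[R2 / R1]invrK invf_div; apply/andP; split.
  by rewrite -[_ `^ P _]invrK -powRN ltf_pV2 ?posrE ?powR_gt0.
by rewrite -[_ `^ P _]invrK -powRN ltf_pV2 ?posrE ?powR_gt0.
Qed.

Lemma laurent_sector (R : realType) (N : nat) (lnq q : R[i]) (i j : nat)
    (P : int -> R) (k : int) (R1 R2 : R) :
  (0 < N)%N -> q != 0 -> absC q < 1 -> cexp lnq = q -> is_enumeration N i j P ->
  in_sector q P k R1 R2 ->
  laurent (f_ij N lnq q i j) (R2 / R1)
  = corner_coeff N lnq q i j (shell_index N (P k)).
Proof.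
move=> N0 q0 q1 hq hP /(sector_radius q0) /andP[h1 h2]; apply: laurentE.
exists (absC q `^ P (k + 1)), (absC q `^ P k).
rewrite powR_ge0 h1 h2; split=> //; split=> // x hx.
exact: laurent_f_ij_sector.
Qed.

(** Transports [laurent_sector] to the circle of inverse radius by [f_ijV]. *)
Lemma laurent_sectorV (R : realType) (N : nat) (lnq q : R[i]) (i j : nat)
    (P : int -> R) (k : int) (R1 R2 : R) :
  (0 < N)%N -> q != 0 -> absC q < 1 -> cexp lnq = q -> is_enumeration N i j P ->
  in_sector q P k R1 R2 ->
  laurent (f_ij N lnq q i j) (R1 / R2)
  = fun p => - corner_coeff N lnq q i j (shell_index N (P k)) (- p).
Proof.
move=> N0 q0 q1 hq hP hs; have [R10 R20 _] := hs.
move: hs => /(sector_radius q0) /andP[h1 h2].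
have a0 : 0 < absC q by rewrite absC_gt0.
have R0 : 0 < R2 / R1 by rewrite divr_gt0.
apply: laurentE; exists (absC q `^ P k)^-1, (absC q `^ P (k + 1))^-1.
rewrite -invf_div invr_ge0 powR_ge0 !ltf_pV2 ?posrE ?powR_gt0// h1 h2.
split=> //; split=> // x /andP[x1 x2].
have x0 : 0 < absC x by rewrite (lt_trans _ x1)// invr_gt0 powR_gt0.
have := @laurent_f_ij_sector R N lnq q i j P k x^-1 N0 q0 q1 hq hP.
rewrite absCV -[_ `^ P k]invrK -[_ `^ P (k + 1)]invrK.
rewrite !ltf_pV2 ?posrE ?invr_gt0 ?powR_gt0// x1 x2 => /(_ isT).
move=> /laurent_sumV /(laurent_sumZ (-1)); rewrite invrK f_ijV// mulN1r opprK.
by apply: laurent_sum_ext => p; rewrite mulN1r.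
Qed.

(** * Formal sums of monomials *)

(** A monomial [mu] that contains the variable [(i, n + r)] leaves finitely many
choices of [r], since [mu] has finite support. *)
Lemma ss_fibre_finite (i j : nat) (n m : int) (mu : monomial) :
  finite_set [set r : int | ss i (n + r) j (m - r) = mu].
Proof.
apply: (@sub_finite_set _ _ [set r : int | (i, n + r) \in finsupp mu]).
  by move=> r /= <-; rewrite msuppE; exact: mset21.
apply: (@finite_preimage _ _ [set` finsupp mu] (fun r : int => (i, n + r))).
  by move=> x y _ _ [] /addrI.
exact: finite_fset.
Qed.

Lemma eq_formal_sum (R : realType) (c d : int -> R[i]) (M : int -> monomial) mu :
  c =1 d -> formal_sum c M mu = formal_sum d M mu.
Proof. by move=> /funext ->. Qed.

Lemma formal_sumD (R : realType) (c d : int -> R[i]) (M : int -> monomial) mu :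
  finite_set [set r | M r = mu] ->
  formal_sum (fun r => c r + d r) M mu = formal_sum c M mu + formal_sum d M mu.
Proof. by move=> fM; rewrite /formal_sum fsbig_split. Qed.

Lemma formal_sumZ (R : realType) (a : R[i]) (c : int -> R[i])
    (M : int -> monomial) mu :
  finite_set [set r | M r = mu] ->
  formal_sum (fun r => a * c r) M mu = a * formal_sum c M mu.
Proof. by move=> fM; rewrite /formal_sum -fsbig_distrr. Qed.

Lemma formal_sum_sum (R : realType) (I : Type) (s : seq I) (c : I -> int -> R[i])
    (M : int -> monomial) mu :
  finite_set [set r | M r = mu] ->
  formal_sum (fun r => \sum_(t <- s) c t r) M mu
  = \sum_(t <- s) formal_sum (c t) M mu.
Proof.
move=> fM; elim: s => [|t s IH].
  rewrite big_nil /formal_sum fsbig1// => r _.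
  by rewrite big_nil.
rewrite big_cons -IH -formal_sumD//; apply: eq_formal_sum => r.
by rewrite big_cons.
Qed.

(** Used with [h r = - (2 * r)], to drop the odd powers of [x]. *)
Lemma formal_sum_reindex (R : realType) (c : int -> R[i]) (M : int -> monomial)
    (h : int -> int) mu :
  injective h -> (forall p, ~ range h p -> c p = 0) ->
  formal_sum (c \o h) (M \o h) mu = formal_sum c M mu.
Proof.
move=> hinj c0; rewrite /formal_sum.
rewrite -[RHS](@fsbig_widen _ _ _ _ (h @` [set r | M (h r) = mu])); last 2 first.
- by move=> _ [r hr <-].
- move=> p [/= Mp hp]; apply: c0 => -[r _ rp]; apply: hp.
  by exists r => //=; rewrite rp.
by rewrite fsbig_image//= => x y _ _ /hinj.
Qed.

(** * Mode brackets *)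

Lemma mode_bracketE (R : realType) (N : nat) (lnq q : R[i]) (i j : nat)
    (P : int -> R) (k : int) (R1 R2 : R) (n m : int) (mu : monomial) :
  (0 < N)%N -> q != 0 -> absC q < 1 -> cexp lnq = q -> is_enumeration N i j P ->
  in_sector q P k R1 R2 ->
  mode_bracket N lnq q i j R1 R2 n m mu
  = formal_sum (sector_coeff N lnq q i j P k) (fun r => ss i (n + r) j (m - r)) mu.
Proof.
move=> N0 q0 q1 hq hP hs; rewrite /mode_bracket /sector_coeff /contour.
rewrite (laurent_sector N0 q0 q1 hq hP hs) (laurent_sectorV N0 q0 q1 hq hP hs).
have fM := ss_fibre_finite i j n m mu.
by case: ifP => // _; rewrite -formal_sumD// formal_sumZ.
Qed.

(** For [k < 0] the boundaries are crossed in the opposite direction, whence the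
sign. *)
Lemma crossed_telescope (V : comNzRingType) (u : int -> V) (k : int) :
  u k - u 0 =
  \sum_(s <- crossed k) (if 0 <= k then 1 else -1) * (u s - u (s - 1)).
Proof.
rewrite -mulr_sumr /crossed; case: k => n.
  rewrite lez_nat leq0n mul1r big_map absz_nat.
  elim: n => [|n IH]; first by rewrite big_nil subrr.
  rewrite -addn1 iotaD big_cat big_seq1 -IH /=.
  by rewrite add1n addn1 intS [1 + _]addrC addrK; ring.
rewrite [0 <= Negz n](_ : _ = false)// mulN1r big_map (_ : `|Negz n|%N = n.+1)//.
elim: n => [|n IH].
  by rewrite big_seq1 oppr0 sub0r opprB.
rewrite -[n.+2]addn1 iotaD big_cat big_seq1 opprD -IH /=.
have -> : Negz n.+1 = - (0 + n.+1)%N%:Z - 1 by lia.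
have -> : Negz n = - (0 + n.+1)%N%:Z by lia.
by ring.
Qed.

(** For [i < j] the single circle only meets [|x| = |q| ^ P s]. For [i = j] the
second circle also meets [|x| = |q| ^ (- P s)], with the opposite weight. *)
Lemma sector_coeff_crossed (R : realType) (N : nat) (lnq q : R[i]) (i j : nat)
    (P : int -> R) (k : int) :
  (0 < N)%N -> q != 0 -> absC q < 1 -> cexp lnq = q -> is_enumeration N i j P ->
  exists c : int -> bool -> bool -> R[i], forall p,
    sector_coeff N lnq q i j P k p = sector_coeff N lnq q i j P 0 p +
      \sum_(s <- crossed k) \sum_(e : bool) \sum_(e' : bool)
        c s e e' * ((-1) ^+ e * qpow lnq ((-1) ^+ e' * P s)) ^ p.
Proof.
move=> N0 q0 q1 hq hP.
pose J := jump_weight N lnq i j P.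
pose sg : R[i] := if 0 <= k then 1 else -1.
exists (fun s e e' => sg * if i == j then (if e' then 1 else -1) * (J s / 2)
                      else if e' then J s else 0) => p.
apply/eqP; rewrite addrC -subr_eq; apply/eqP.
pose u s := sector_coeff N lnq q i j P s p.
rewrite -/(u k) -/(u 0) crossed_telescope; apply: eq_bigr => s _.
have jump := corner_coeff_jump s _ N0 q0 q1 hq hP.
have sgnV (e : bool) : ((-1) ^+ e * qpow lnq (- P s)) ^ (- p)
    = ((-1) ^+ e * qpow lnq (P s)) ^ p.
  rewrite -exprz_inv invfM -qpowN opprK; congr ((_ * _) ^ p).
  by case: e; rewrite ?expr1 ?invrN1 ?expr0 ?invr1.
under eq_bigr do rewrite big_bool expr1 expr0 mulN1r !mul1r.
rewrite big_bool /u /sector_coeff -/sg; case: ifP => _.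
  have -> : forall a b c d : R[i], 2^-1 * (a - b) - 2^-1 * (c - d)
    = 2^-1 * ((a - c) - (b - d)) by move=> a b c d; ring.
  rewrite (jump p) (jump (- p)).
  rewrite !big_bool (sgnV true) (sgnV false) -/(J s).
  have E (x y z t w g : R[i]) : g * (2^-1 * (w * (x + y) - w * (z + t)))
      = g * (w / 2) * x + g * (-1 * (w / 2)) * z
        + (g * (w / 2) * y + g * (-1 * (w / 2)) * t) by ring.
  exact: E.
rewrite (jump p) !big_bool -/(J s).
have E (x y w g a b : R[i]) : g * (w * (x + y)) = g * w * x + g * 0 * a
    + (g * w * y + g * 0 * b) by ring.
exact: E.
Qed.

Theorem proposition4 (R : realType) (N : nat) (q lnq : R[i]) (i j : nat)
    (P : int -> R) (k : int)
    (hN : (2 <= N)%N)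
    (hlnq : cexp lnq = q) (hq : 0 < absC q < 1)
    (hi : (1 <= i <= N - 1)%N) (hj : (1 <= j <= N - 1)%N) (hij : (i <= j)%N)
    (hP : is_enumeration N i j P)
    (hk : i = j -> 0 <= k) :
  (forall R1 R2 : R, in_sector q P 0 R1 R2 ->
     forall (n m : int) (mu : monomial),
       mode_bracket N lnq q i j R1 R2 n m mu =
       - 2 * lnq * (q - q^-1) *
         formal_sum
           (fun r => qnum q ((N - maxn i j)%:Z * r) * qnum q ((minn i j)%:Z * r)
                     / qnum q (N%:Z * r))
           (fun r => ss i (n - 2 * r) j (m + 2 * r)) mu) /\
  (exists c : int -> bool -> bool -> R[i],
     forall R1 R2 R1' R2' : R,
       in_sector q P k R1 R2 -> in_sector q P 0 R1' R2' ->
       forall (n m : int) (mu : monomial),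
         mode_bracket N lnq q i j R1 R2 n m mu =
         mode_bracket N lnq q i j R1' R2' n m mu +
         \sum_(s <- crossed k) \sum_(e : bool) \sum_(e' : bool)
           c s e e' *
           formal_sum
             (fun r => ((-1) ^+ e * qpow lnq ((-1) ^+ e' * P s)) ^ r)
             (fun r => ss i (n + r) j (m - r)) mu).
Proof.
have N0 : (0 < N)%N by apply: leq_trans hN.
have /andP[q0' q1] := hq; have q0 : q != 0 by rewrite -absC_gt0.
split=> [R1 R2 hs n m mu|].
  rewrite (mode_bracketE n m mu N0 q0 q1 hlnq hP hs).
  (* Only even powers of [x] occur, and [x ^ p] goes with
     [s_i(n + p) s_j(m - p)]: the index [r] of the claim has [p = - (2 * r)]. *)
  pose h r : int := - (2 * r).
  rewrite -(@formal_sum_reindex _ _ _ h); first last.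
  - move=> p hp; apply: sector_coeff_odd; apply: contrapT => /negP ev; apply: hp.
    by exists (- (p %/ 2)%Z) => //; rewrite /h; lia.
  - by move=> x y; rewrite /h; lia.
  have [_ _ P0] := hP.
  rewrite (_ : _ \o h = fun r => ss i (n - 2 * r) j (m + 2 * r)); last first.
    by apply/funext => r; rewrite /= /h opprK.
  rewrite -formal_sumZ.
    apply: eq_formal_sum => r /=; rewrite /h.
    by rewrite (sector0_coeff lnq r q0 q1 hN hi hj hij P0).
  apply: (sub_finite_set _ (finite_preimage (f := h) _ (ss_fibre_finite i j n m mu))).
    by move=> r /= <- /=; rewrite /h opprK.
  by move=> x y _ _; rewrite /h; lia.
have [c hc] := sector_coeff_crossed k N0 q0 q1 hlnq hP.
exists c => R1 R2 R1' R2' hs hs' n m mu.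
rewrite (mode_bracketE n m mu N0 q0 q1 hlnq hP hs).
rewrite (mode_bracketE n m mu N0 q0 q1 hlnq hP hs').
have fM := ss_fibre_finite i j n m mu.
rewrite (eq_formal_sum _ _ hc) formal_sumD// formal_sum_sum//; congr (_ + _).
apply: eq_bigr => s _; rewrite formal_sum_sum//; apply: eq_bigr => e _.
by rewrite formal_sum_sum//; apply: eq_bigr => e' _; rewrite formal_sumZ.
Qed.
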